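(* Let $(\mathcal{H},g)\subset\{h=1\}\subset\mathbb{R}^n$ be a pseudo-Riemannian cubic hypersurface with basic polynomial $h$, whose canonical metric $g$ has signature $(k,l)$. Let $U=\mathbb{R}^n+i\,\mathbb{R}^+\!\cdot\mathcal{H}\subset\mathbb{C}^n$ be the associated tube domain with its canonical metric $g^c$, let $g^{F_h}$ be the special metric on the projectivized Lagrangean cone $P(\mathcal{C}_{F_h})$ defined by $F_h(z^0,\dots,z^n)=h(z^1,\dots,z^n)/z^0$, let $\varphi:U\to P(\mathcal{C}_{F_h})$ be the biholomorphism $\varphi(Z)=\pi(dF_h|_{(1,Z)})$, and put $g^s=\varphi^*g^{F_h}$. Then the metrics $$g^c=g^s=\varphi^*g^{F_h}\quad\text{and}\quad g^{F_h}$$ are special pseudo-Kählerian of complex signature $(k+1,l)$. In particular, the r-map maps special real manifolds (i.e. Riemannian cubic hypersurfaces) to special Kähler manifolds.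
   Context: **Hypersurfaces.** A hypersurface of degree $d$ with basic polynomial $h$ is a smooth, open and connected subset $\mathcal{H}$ of the level set $\{h=1\}\subset\mathbb{R}^n$, where $h$ is a real homogeneous polynomial of degree $d$ which is not a power of a polynomial of lower degree; it is cubic if $d=3$. Let $H$ be the symmetric $d$-linear form with $h(X)=H(X,\dots,X)$. For $d\ge2$ the canonical metric of $\mathcal{H}$ is $g_{X_0}(X,X)=-(d-1)H(X_0,\dots,X_0,X,X)$ for $X_0\in\mathcal{H}$, $X\in T_{X_0}\mathcal{H}=\{X: H(X_0,\dots,X_0,X)=0\}$. $\mathcal{H}$ is pseudo-Riemannian if $g$ is nondegenerate, Riemannian if $g$ is positive definite. A special real manifold is a Riemannian cubic hypersurface. **Tube domain.** On $U=\mathbb{R}^n+i\mathcal{V}$, $\mathcal{V}=\mathbb{R}^+\cdot\mathcal{H}$, with coordinates $Z=X+iY$, the canonical metric is the pseudo-Kähler metric $g^c=\sum_{i,j}\frac{\partial^2K}{\partial z^i\partial\bar z^j}dz^i\otimes d\bar z^j$ with Kähler potential $K(Z)=-\frac4d\log h(Y)$ (here $d=3$). **Lagrangean cones and special metrics.** Let $V=T^*\mathbb{C}^{n+1}$ with its standard complex symplectic form $\omega=\sum_{j=0}^n(dz^j\otimes dp_j-dp_j\otimes dz^j)$ in the canonical coordinates $(z^j,p_j)$, let $\tau$ be complex conjugation with respect to $T^*\mathbb{R}^{n+1}$, and let $\gamma(X,Y)=i\,\omega(X,\tau Y)$, a Hermitian form. A Lagrangean cone is a connected submanifold $\mathcal{C}\subset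 V$ with $\mathbb{R}^+\cdot\mathcal{C}=\mathcal{C}$ all of whose tangent spaces are (complex) Lagrangean subspaces of $V$. Let $\pi$ denote the canonical projection from $V$ to $P(V)$. If $\gamma$ is nondegenerate on the tangent spaces of $\mathcal{C}$ and $\gamma(u,u)\neq0$ for all $u\in\mathcal{C}$, the special metric of $P(\mathcal{C})=\pi(\mathcal{C})$ is $$g^{P(\mathcal{C})}_{\pi u}(d\pi v,d\pi v)=\frac{\gamma(v,v)}{\gamma(u,u)}-\left|\frac{\gamma(u,v)}{\gamma(u,u)}\right|^2,\qquad u\in\mathcal{C},\ v\in T_u\mathcal{C}.$$ A pseudo-Kähler manifold is called special if it is locally isometric to $(P(\mathcal{C}),g^{P(\mathcal{C})})$ for some Lagrangean cone $\mathcal{C}$. **The r-map.** For a locally defined holomorphic function $F$ on $\mathbb{C}^{n+1}$, homogeneous of degree 2, $\mathcal{C}_F\subset T^*\mathbb{C}^{n+1}$ denotes the image of $dF:Z\mapsto dF|_Z$, and $g^F:=g^{P(\mathcal{C}_F)}$. The r-map maps a homogeneous cubic polynomial $h$ on $\mathbb{R}^n$ to the (possibly degenerate) special metric $g^{F_h}$. Here $F_h$ is considered on the cone $\{z^0(1,Z): z^0\in\mathbb{C}^*,\ Z\in U\}$, so that $\varphi$ is a biholomorphism of $U$ onto $P(\mathcal{C}_{F_h})$.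
   Formalization: The special metric is multiplied by -4/3, also in the definition of ''special'': with the printed formula g^c = -(4/3) φ^*g^{F_h}, so the equality and the signature fail (e.g. h = x²y). *)

(* Defs.v *)
From HB Require Import structures.
From mathcomp Require Import all_boot all_order all_algebra.
From mathcomp Require Import complex.
From mathcomp Require Import all_classical all_reals all_analysis.
(* mpoly's notations clash with those of mathcomp-analysis *)
From mathcomp Require Import -(notations) mpoly.

Set Implicit Arguments.
Unset Strict Implicit.
Unset Printing Implicit Defensive.

Import Order.TTheory GRing.Theory Num.Theory.
Import numFieldNormedType.Exports.

Local Open Scope classical_set_scope.
Local Open Scope ring_scope.

(* R[i] with its usual topology, as a normed space over itself; with it,
   [differentiable] and ['d] on 'rV[R[i]]_m are complex differentiability and
   the complex differential. *)
HB.instance Definition _ (R : realType) := NormedModule.copy R[i] R[i]^o.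

Section CubicHypersurface.
Variables (R : realType) (n : nat).
Implicit Types (h : mpoly n R) (S : set 'rV[R]_n) (X Y : 'rV[R]_n).

Definition evalr h X : R := meval (fun i => X 0 i) h.

Definition power_of_lower_degree h :=
  exists (q : mpoly n R) (m : nat),
    (mmeasure mdeg q < mmeasure mdeg h)%N /\ h = q ^+ m.

Definition cubic_hypersurface h S :=
  [/\ h != 0 /\ h \is ishomog1 3 mdeg,
      ~ power_of_lower_degree h,
      exists2 O : set 'rV[R]_n, open O & S = O `&` [set X | evalr h X = 1],
      connected S
    & forall X, S X -> exists i, evalr (mderiv i h) X != 0].

Definition polar_form h (H : 'rV[R]_n -> 'rV[R]_n -> 'rV[R]_n -> R) :=
  [/\ forall a X X' Y Z, H (a *: X + X') Y Z = a * H X Y Z + H X' Y Z,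
      forall X Y Z, H X Y Z = H Y X Z,
      forall X Y Z, H X Y Z = H X Z Y
    & forall X, evalr h X = H X X X].

Variable H : 'rV[R]_n -> 'rV[R]_n -> 'rV[R]_n -> R.

Definition tangent_hyp X0 X := H X0 X0 X = 0.

(* - (d - 1) H(X0, ..., X0, X, Y) with d = 3 *)
Definition canonical_metric X0 X Y : R := - 2%:R * H X0 X Y.

Definition pseudo_riemannian S := forall X0 X, S X0 -> tangent_hyp X0 X ->
  (forall Y, tangent_hyp X0 Y -> canonical_metric X0 X Y = 0) -> X = 0.

Definition riemannian S := forall X0 X, S X0 -> tangent_hyp X0 X ->
  X != 0 -> 0 < canonical_metric X0 X X.

(* the rows of E form a pseudo-orthonormal basis of the tangent space *)
Definition has_signature S (k l : nat) := forall X0, S X0 ->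
  exists E : 'M[R]_(k + l, n),
    (forall X, (X <= E)%MS <-> tangent_hyp X0 X) /\
    (forall i j, canonical_metric X0 (row i E) (row j E) =
       if i == j then (if (i < k)%N then 1 else -1) else 0).

End CubicHypersurface.

Section ComplexAnalysis.
Variable R : realType.
Local Notation C := R[i].

Definition holomorphic_on (U V : normedModType C) (W : set U) (f : U -> V) :=
  forall z, W z -> differentiable f z.

Variable m : nat.
Implicit Types (f : 'rV[C]_m -> C) (W : set 'rV[C]_m).

(* derivative along the real direction v *)
Definition rdir (v : 'rV[C]_m) f (z : 'rV[C]_m) : C :=
  Complex (derive1 (fun t : R => complex.Re (f (z + (t%:C)%C *: v))) 0)
          (derive1 (fun t : R => complex.Im (f (z + (t%:C)%C *: v))) 0).

Definition rderivable (v : 'rV[C]_m) f (z : 'rV[C]_m) :=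
  derivable (fun t : R => complex.Re (f (z + (t%:C)%C *: v))) 0 1 /\
  derivable (fun t : R => complex.Im (f (z + (t%:C)%C *: v))) 0 1.

(* C^infinity over the reals *)
Definition smooth_on W f := forall (vs : seq 'rV[C]_m) z, W z ->
  {for z, continuous (foldr rdir f vs)} /\
  (forall v, rderivable v (foldr rdir f vs) z).

(* Wirtinger derivatives d/dz^j and d/d(conj z)^j *)
Definition dz (j : 'I_m) f (z : 'rV[C]_m) : C :=
  (rdir (delta_mx 0 j) f z - 'i * rdir ('i *: delta_mx 0 j) f z) / 2%:R.

Definition dzbar (j : 'I_m) f (z : 'rV[C]_m) : C :=
  (rdir (delta_mx 0 j) f z + 'i * rdir ('i *: delta_mx 0 j) f z) / 2%:R.

End ComplexAnalysis.

Section HermitianForms.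
Variables (R : realType) (m : nat).
Local Notation C := R[i].
Implicit Types G : 'M[C]_m.

(* The matrix G stands for the sesquilinear form
   sum_(i, j) G i j dz^i (x) d(conj z)^j *)
Definition hval G (w : 'rV[C]_m) : C :=
  \sum_i \sum_j G i j * w 0 i * (w 0 j)^*.

Definition hermitian_mx G := (map_mx Num.conj G)^T = G.

Definition posdef_mx G := forall w : 'rV[C]_m, w != 0 -> 0 < hval G w.

Definition hermitian_signature G (p q : nat) := (p + q)%N = m /\
  exists2 P : 'M[C]_m, P \in unitmx &
    P *m G *m (map_mx Num.conj P)^T =
    diag_mx (\row_i (if (i < p)%N then 1 else -1)).

End HermitianForms.

(* A complex manifold of dimension m with a Hermitian metric is given by an
   atlas: local parametrizations of a set of points of T by open subsets of
   C^m, each carrying the coefficients of the metric in these coordinates.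
   The functions par and met are only meaningful on dom. *)
Record chart (R : realType) (m : nat) (T : Type) := Chart {
  dom : set 'rV[R[i]]_m;
  par : 'rV[R[i]]_m -> T;
  met : 'rV[R[i]]_m -> 'M[R[i]]_m
}.

Section Manifolds.
Variable R : realType.
Local Notation C := R[i].

Definition points m T (A : set (chart R m T)) : set T :=
  \bigcup_(c in A) (par c @` dom c).

(* In the charts c and c', f is holomorphic and preserves the metrics. *)
Definition chart_isometric m T m' T' (f : T -> T')
    (c : chart R m T) (c' : chart R m' T') :=
  let D := [set z | dom c z /\ (par c' @` dom c') (f (par c z))] in
  exists t : 'rV[C]_m -> 'rV[C]_m',
    [/\ open D, holomorphic_on D t
      & forall z, D z ->
          [/\ dom c' (t z), par c' (t z) = f (par c z)
            & forall w, hval (met c z) w = hval (met c' (t z)) ('d t z w)]].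

Definition hermitian_manifold m T (A : set (chart R m T)) :=
  [/\ forall c, A c -> open (dom c) /\ set_inj (dom c) (par c),
      forall c c', A c -> A c' -> chart_isometric idfun c c',
      forall x y, points A x -> points A y -> x <> y ->
        exists c c' (W W' : set 'rV[C]_m),
          [/\ A c /\ A c', open W /\ open W',
              W `<=` dom c /\ W' `<=` dom c',
              (par c @` W) x /\ (par c' @` W') y
            & (par c @` W) `&` (par c' @` W') = set0]
    & exists2 B : set (chart R m T), B `<=` A /\ countable B &
        points B = points A].

(* Smoothness and closedness do not depend on the chart, so they are required
   in one chart around each point. With the Kahler form proportional to
   sum_(i,j) G i j dz^i /\ d(conj z)^j, the last condition is the vanishing of
   the (2,1)-part of its exterior derivative; since G is Hermitian, so is that
   of the (1,2)-part. *)
Definition pseudo_kahler m T (A : set (chart R m T)) :=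
  [/\ hermitian_manifold A,
      forall c z, A c -> dom c z ->
        hermitian_mx (met c z) /\ met c z \in unitmx
    & forall x, points A x -> exists c,
        [/\ A c, (par c @` dom c) x,
            forall i j, smooth_on (dom c) (fun z => met c z i j)
          & forall z (i j k : 'I_m), dom c z ->
              dz k (fun z' => met c z' i j) z =
              dz i (fun z' => met c z' k j) z]].

Definition complex_signature m T (A : set (chart R m T)) (p q : nat) :=
  forall c z, A c -> dom c z -> hermitian_signature (met c z) p q.

Definition kahler m T (A : set (chart R m T)) :=
  pseudo_kahler A /\ forall c z, A c -> dom c z -> posdef_mx (met c z).

(* f restricts to a biholomorphism from the points of A onto the points of B
   pulling back the metric of B to the metric of A. *)
Definition biholomorphic_isometry m T T' (f : T -> T')
    (A : set (chart R m T)) (B : set (chart R m T')) :=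
  exists g : T' -> T,
    [/\ forall x, points A x -> points B (f x) /\ g (f x) = x,
        forall y, points B y -> points A (g y) /\ f (g y) = y
      & forall c c', A c -> B c' ->
          chart_isometric f c c' /\ chart_isometric g c' c].

Definition locally_isometric m T T'
    (A : set (chart R m T)) (B : set (chart R m T')) :=
  forall x, points A x ->
    exists (c : chart R m T) (c' : chart R m T') (W W' : set 'rV[C]_m)
           (f g : 'rV[C]_m -> 'rV[C]_m),
      [/\ A c /\ B c',
          (open W /\ W `<=` dom c) /\ (par c @` W) x,
          open W' /\ W' `<=` dom c',
          [/\ holomorphic_on W f, holomorphic_on W' g,
              forall z, W z -> W' (f z) /\ g (f z) = z
            & forall z, W' z -> W (g z) /\ f (g z) = z]
        & forall z w, W z ->
            hval (met c z) w = hval (met c' (f z)) ('d f z w)].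

End Manifolds.

Section LagrangeanCones.
Variables (R : realType) (m : nat).
Local Notation C := R[i].
(* T^*C^(m+1), with elements (z, p) *)
Local Notation V := ('rV[C]_(1 + m) * 'rV[C]_(1 + m))%type.
Implicit Types (u v : V) (L : set V).

Definition omega u v : C :=
  \sum_j (u.1 0 j * v.2 0 j - u.2 0 j * v.1 0 j).

Definition tau u : V := (map_mx Num.conj u.1, map_mx Num.conj u.2).

Definition gamma u v : C := 'i * omega u (tau v).

(* Embedded complex submanifolds of dimension m + 1: near each of its points,
   L is the image of a holomorphic map s with a holomorphic left inverse r. *)
Definition submanifold L := forall u, L u ->
  exists (W : set 'rV[C]_(1 + m)) (O : set V)
         (s : 'rV[C]_(1 + m) -> V) (r : V -> 'rV[C]_(1 + m)),
    [/\ open W, open O /\ O u,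
        holomorphic_on W s /\ holomorphic_on O r,
        s @` W = L `&` O
      & forall z, W z -> r (s z) = z].

(* velocities at u of the holomorphic curves in L through u *)
Definition tangent L u : set V := [set v | exists c : C -> V,
  [/\ c 0 = u, \forall t \near (0 : C), L (c t) & is_derive (0 : C) 1 c v]].

(* the last condition: each tangent space is its own omega-orthogonal *)
Definition lagrangean_cone L :=
  [/\ connected L, submanifold L,
      forall (t : R) u, 0 < t -> L u -> L ((t%:C)%C *: u)
    & forall u, L u -> forall v,
        tangent L u v <-> (forall w : V, tangent L u w -> omega v w = 0)].

Definition nondegenerate_lagrangean_cone L :=
  [/\ lagrangean_cone L,
      forall u, L u -> gamma u u != 0
    & forall u v, L u -> tangent L u v ->
        (forall w : V, tangent L u w -> gamma v w = 0) -> v = 0].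

(* Pitfall: the factor - 4/3 is not part of the usual formula
     gamma(v, v) / gamma(u, u) - |gamma(u, v) / gamma(u, u)|^2 ;
   it is the normalization for which g^c = phi^* g^(F_h) holds. Indeed, for
   F = h(z^1, ..., z^n) / z^0 one has gamma(u, u) = 8 h(Im Z) at u = dF(1, Z),
   so that this formula gives the Levi form of log h(Im Z), whereas the canonical
   metric of the tube domain has the potential - 4/3 log h(Im Z). *)
Definition special_metric u v : C :=
  - (4%:R / 3%:R) * (gamma v v / gamma u u - `|gamma u v / gamma u u| ^+ 2).

(* P(L) as a complex submanifold of P(V), with the special metric; a point of
   P(V) is a line <[u]> in V. A chart z |-> <[s z]> is given by a holomorphic
   lift s to L, and a holomorphic function r on an open subset of P(V) (i.e. an
   invariant function on an invariant open set O) restricts to its inverse. *)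
Definition projectivization L : set (chart R m {vspace V}) :=
  [set c | open (dom c) /\
    exists (s : 'rV[C]_m -> V) (O : set V) (r : V -> 'rV[C]_m),
      [/\ holomorphic_on (dom c) s,
          forall z, dom c z -> [/\ L (s z), O (s z), r (s z) = z
                                 & par c z = <[s z]>%VS],
          [/\ open O, ~ O 0, holomorphic_on O r
            & forall u (a : C), a != 0 -> O u ->
                O (a *: u) /\ r (a *: u) = r u],
          forall u, L u -> O u -> exists2 z, dom c z & <[u]>%VS = <[s z]>%VS
        & forall z, dom c z -> hermitian_mx (met c z) /\
            forall w : 'rV[C]_m,
              hval (met c z) w = special_metric (s z) ('d s z w)]].

(* z |-> dF|_z *)
Definition dgraph (F : 'rV[C]_(1 + m) -> C) (z : 'rV[C]_(1 + m)) : V :=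
  (z, \row_j 'D_(delta_mx 0 j) F z).

End LagrangeanCones.

Definition special (R : realType) (m : nat) T (A : set (chart R m T)) :=
  exists L : set ('rV[R[i]]_(1 + m) * 'rV[R[i]]_(1 + m)),
    nondegenerate_lagrangean_cone L /\ locally_isometric A (projectivization L).

Definition special_pseudo_kahler (R : realType) (m : nat) T
  (A : set (chart R m T)) := pseudo_kahler A /\ special A.

Definition special_kahler (R : realType) (m : nat) T
  (A : set (chart R m T)) := kahler A /\ special A.

Section RMap.
Variables (R : realType) (n : nat) (h : mpoly n R) (S : set 'rV[R]_n).
Local Notation C := R[i].
Local Notation V := ('rV[C]_(1 + n) * 'rV[C]_(1 + n))%type.

Definition tube : set 'rV[C]_n :=
  [set Z | exists (t : R) (Y : 'rV[R]_n),
     [/\ 0 < t, S Y & map_mx (@complex.Im R) Z = t *: Y]].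

Definition kahler_potential (Z : 'rV[C]_n) : R :=
  - (4%:R / 3%:R) * ln (evalr h (map_mx (@complex.Im R) Z)).

Definition gc (Z : 'rV[C]_n) : 'M[C]_n :=
  \matrix_(i, j) dz i (dzbar j (fun Z' => (kahler_potential Z')%:C%C)) Z.

(* the tube domain with its canonical metric *)
Definition tube_domain : set (chart R n 'rV[C]_n) := [set Chart tube idfun gc].

(* z = (z^0, z') |-> h(z') / z^0 *)
Definition prepotential (z : 'rV[C]_(1 + n)) : C :=
  meval (fun i => rsubmx z 0 i) (map_mpoly (real_complex R) h) / lsubmx z 0 0.

Definition affine_lift (Z : 'rV[C]_n) : V :=
  dgraph prepotential (row_mx 1%:M Z).

Definition phi (Z : 'rV[C]_n) : {vspace V} := <[affine_lift Z]>%VS.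

(* the Hermitian square of w for phi^* g^(F_h) at Z *)
Definition gs (Z w : 'rV[C]_n) : C :=
  special_metric (affine_lift Z) ('d affine_lift Z w).

Definition cone_domain : set 'rV[C]_(1 + n) :=
  [set z | exists (z0 : C) (Z : 'rV[C]_n),
     [/\ z0 != 0, tube Z & z = z0 *: row_mx 1%:M Z]].

Definition lagrangean_cone_of : set V := dgraph prepotential @` cone_domain.

Definition r_map : set (chart R n {vspace V}) :=
  projectivization lagrangean_cone_of.

End RMap.

(* Main.v *)
(* Let T be the symmetric trilinear form of h, extended to C^n, and let
   Y = Im Z. The lift u(Z) = dF(1, Z) satisfies
     gamma(u(Z), u(Z)) = i T(Z - conj Z, Z - conj Z, Z - conj Z) = 8 h(Y),
   and, by polarization and differentiation,
     gamma(u, du(w)) = 12 i T(Y, Y, conj w),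
     gamma(du(v), du(w)) = 12 T(Y, v, conj w).
   Hence the special metric is the Hermitian extension of the real form
     g_Y(v, w) = - 2 T(Y, v, w) / h(Y) + 3 T(Y, Y, v) T(Y, Y, w) / h(Y)^2,
   which is also the Levi form of - 4/3 log h(Im Z). If Y lies on the
   hypersurface, then Y is a unit vector for g_Y orthogonal to the tangent
   space, on which g_Y is the canonical metric; this gives the signature
   (k + 1, l), and homogeneity covers the rest of the tube. The tangent spaces
   of the cone are the graphs of the Hessian of F, so they are Lagrangean
   because the Hessian is symmetric. An arbitrary chart of the projectivized
   cone is compared with the tube by the affine coordinates z^j / z^0. *)

Require Import Defs.
From mathcomp Require Import all_boot all_order all_algebra.
From mathcomp Require Import complex.
From mathcomp Require Import all_classical all_reals all_analysis.
From mathcomp Require Import -(notations) mpoly.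
From mathcomp Require Import ring zify.

Set Implicit Arguments.
Unset Strict Implicit.
Unset Printing Implicit Defensive.

Import Order.TTheory GRing.Theory Num.Theory.
Import numFieldNormedType.Exports.

Local Open Scope classical_set_scope.
Local Open Scope ring_scope.

(** * Differential calculus *)

(** The data are replaced by objects on which [ring] and [field] decide everything. The given [H]
    equals the explicit form [cubic_polar], whose coefficients can be carried to [C]; conjugation
    then only exchanges [X + iY] and [X - iY]. Since the potential depends on [Y] alone, Wirtinger
    derivatives are real partial derivatives up to a constant factor, and the coefficients of [gc]
    are rational functions of [Y] with a power of [h] as denominator, a class stable under
    differentiation. The obstacle is the atlas [r_map]: it contains every chart given by any
    holomorphic lift, with the metric prescribed only through its Hermitian squares. All manifold
    properties are therefore proved once, for atlases whose charts are holomorphic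
    reparametrizations of parts of the tube with the pulled back metric ([tube_chart]). This rests
    on two facts: rescaling a lift by a function does not change the special metric
    ([special_metric_scale]), and a complex matrix is determined by its Hermitian squares
    ([hval_inj]). *)

Section DifferentialCalculus.
Variable K : numFieldType.

Lemma is_diff_ext (V W : normedModType K) (f g : V -> W) (df dg : V -> W) x :
  f =1 g -> df =1 dg -> is_diff x f df -> is_diff x g dg.
Proof. by move=> /funext -> /funext ->. Qed.

Lemma is_diff_sum (V W : normedModType K) m (f df : 'I_m -> V -> W) x :
  (forall i, is_diff x (f i) (df i)) ->
  is_diff x (fun y => \sum_i f i y) (fun y => \sum_i df i y).
Proof.
elim: m f df => [|m IH] f df fdf.
  by apply: is_diff_ext (is_diff_cst (0 : W) x) => y; rewrite big_ord0.
have := is_diffD (IH _ _ (fun i => fdf (widen_ord (leqnSn m) i))) (fdf ord_max).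
by apply: is_diff_ext => y; rewrite big_ord_recr.
Qed.

Lemma is_diff_coord m n (M : 'M[K]_(m, n)) i j :
  is_diff M (fun N : 'M[K]_(m, n) => N i j : K) (fun N => N i j).
Proof.
have dM := @differentiable_coord K m n M i j.
apply: DiffDef => //; apply/funext => N; rewrite -deriveE //.
(* The difference quotient of a coordinate does not depend on [t] once [t] is nonzero. *)
apply: cvg_lim => //; apply: cvg_near_cst.
near=> t; rewrite /= !mxE addrK.
have t0 : t != 0 by near: t; exact: nbhs_dnbhs_neq.
by rewrite scalerA mulVf // scale1r.
Unshelve. all: by end_near. Qed.

Lemma is_diff_row (V : normedModType K) n (f df : V -> 'rV[K]_n) x :
  (forall j, is_diff x (fun y => f y 0 j : K) (fun y => df y 0 j)) ->
  is_diff x f df.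
Proof.
move=> fdf.
have /is_diff_sum : forall j, is_diff x (fun y => f y 0 j *: delta_mx 0 j : 'rV[K]_n)
    (fun y => df y 0 j *: delta_mx 0 j).
  move=> j; have [dfj dfE] := fdf j.
  by apply: DiffDef; [exact: differentiableZl | rewrite diffZl // dfE].
by apply: is_diff_ext => y; rewrite [RHS]row_sum_delta.
Qed.

Lemma is_diff_inv (V : normedModType K) (f df : V -> K) x :
  is_diff x f df -> f x != 0 ->
  is_diff x (fun y => (f y)^-1) (fun y => - (f x) ^- 2 * df y).
Proof.
move=> [dfx dfE] fx0; apply: DiffDef; first exact: differentiableV.
by rewrite diffV // dfE.
Qed.

Lemma is_diff_mul (V : normedModType K) (f df g dg : V -> K) x :
  is_diff x f df -> is_diff x g dg ->
  is_diff x (fun y => f y * g y) (fun y => df y * g x + f x * dg y).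
Proof.
move=> fdf gdg; apply: is_diff_ext (is_diffM fdf gdg) => // y.
by rewrite !fctE /GRing.scale /=; ring.
Qed.

(** The remainder of the expansion at [x] with zero linear part is itself zero near [x]. Applied to
    a difference, this gives the locality of differentials in [near_eq_is_diff]. *)
Lemma near0_is_diff (V W : normedModType K) (e : V -> W) x :
  (\near x, e x = 0) -> is_diff x e 0.
Proof.
move=> e0; have ex0 : e x = 0 by exact: (nbhs_singleton e0).
have dE : e \o shift x = cst (e x) + (0 : V -> W) +o_ 0 id.
  apply/eqaddoP => eps eps0.
  move: e0; rewrite (near_shift 0) /= => e0; near=> h.
  rewrite !fctE ex0 addr0 subr0.
  have -> : e (h + x) = 0 by near: h; move: e0; rewrite subr0.
  by rewrite normr0 mulr_ge0 // ltW.
have c0 : continuous (0 : V -> W) by move=> ?; exact: cst_continuous.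
have d0 := @diff_unique _ _ _ e (\0 : {linear V -> W}) x c0 dE.
by apply: DiffDef => //; apply/diff_locallyP; rewrite d0.
Unshelve. all: by end_near. Qed.

Lemma near_eq_is_diff (V W : normedModType K) (f g df : V -> W) x :
  (\near x, f x = g x) -> is_diff x f df -> is_diff x g df.
Proof.
move=> fg fdf.
have e0 : is_diff x (g - f) 0.
  by apply: near0_is_diff; apply: filterS fg => y /= fgy; rewrite !fctE fgy subrr.
by apply: is_diff_ext (is_diffD fdf e0) => y; rewrite !fctE ?addr0 // addrC subrK.
Qed.

Lemma is_diff_unique (V W : normedModType K) (f df dg : V -> W) x :
  is_diff x f df -> is_diff x f dg -> df =1 dg.
Proof. by move=> [_ <-] [_ <-]. Qed.

Lemma is_diff_fst (U W : normedModType K) (p : U * W) :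
  is_diff p (fst : U * W -> U) fst.
Proof.
have cf : continuous (fst : U * W -> U) by move=> q; exact: cvg_fst.
apply: DiffDef; first exact: (linear_differentiable (f := fst)).
exact: (diff_lin (f := fst)).
Qed.

(** The identity is available only on an open set, as happens for transition maps; locality also
    yields the differentiability of [k]. *)
Lemma chain_rule (U V W : normedModType K) (f : U -> V) (g : V -> W) (k : U -> W)
    (D : set U) x :
  open D -> D x -> differentiable f x -> differentiable g (f x) ->
  (forall y, D y -> g (f y) = k y) -> forall w, 'd k x w = 'd g (f x) ('d f x w).
Proof.
move=> oD Dx /differentiableP df /differentiableP dg E w.
have gk : \forall y \near x, (g \o f) y = k y.
  by apply: (filterS E); exact: open_nbhs_nbhs.
by have [_ ->] := near_eq_is_diff gk (is_diff_comp df dg).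
Qed.

Lemma open_preimage (U V : normedModType K) (f : U -> V) (D : set U) (E : set V) :
  open D -> open E -> (forall x, D x -> differentiable f x) ->
  open [set x | D x /\ E (f x)].
Proof.
move=> oD oE df; rewrite openE => x [Dx Efx].
have nD : \forall y \near x, D y by exact: open_nbhs_nbhs.
have nE : \forall y \near x, E (f y).
  by apply: (differentiable_continuous (df x Dx)); exact: open_nbhs_nbhs.
by near=> y; split; near: y.
Unshelve. all: by end_near. Qed.

(** * Polynomials as differentiable functions *)

Section Polynomials.
Variable n : nat.
Implicit Types (p q : mpoly n K) (x : 'rV[K]_n).

(** Stated over any field, so that the same lemmas serve [h] over [R], where this unfolds to
    [evalr], and its image over [C], which occurs in [prepotential]. *)
Definition peval p x : K := meval (fun i => x 0 i) p.

Definition dpeval p x (w : 'rV[K]_n) : K :=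
  \sum_i w 0 i * peval (mderiv i p) x.

Lemma is_diff_peval p x : is_diff x (peval p) (dpeval p x).
Proof.
have D q1 q2 : is_diff x (peval q1) (dpeval q1 x) ->
    is_diff x (peval q2) (dpeval q2 x) ->
    is_diff x (peval (q1 + q2)) (dpeval (q1 + q2) x).
  move=> d1 d2; apply: is_diff_ext (is_diffD d1 d2) => y.
    by rewrite /peval mevalD.
  rewrite /dpeval fctE -big_split; apply: eq_bigr => i _.
  by rewrite /peval mderivD mevalD mulrDr.
have M q1 q2 : is_diff x (peval q1) (dpeval q1 x) ->
    is_diff x (peval q2) (dpeval q2 x) ->
    is_diff x (peval (q1 * q2)) (dpeval (q1 * q2) x).
  move=> d1 d2; apply: is_diff_ext (is_diff_mul d1 d2) => y.
    by rewrite /peval mevalM.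
  rewrite /dpeval mulr_suml mulr_sumr -big_split; apply: eq_bigr => i _.
  by rewrite /peval mderivM mevalD !mevalM /=; ring.
have Cst c : is_diff x (peval (mpolyC n c)) (dpeval (mpolyC n c) x).
  apply: is_diff_ext (is_diff_cst (c : K) x) => y; rewrite /peval ?mevalC //.
  by rewrite /dpeval big1 // => i _; rewrite /peval mderivC meval0 mulr0.
have X i : is_diff x (peval (mpolyX _ (mnm1 i))) (dpeval (mpolyX _ (mnm1 i)) x).
  apply: is_diff_ext (is_diff_coord x 0 i) => y; rewrite /peval ?mevalXU //.
  rewrite /dpeval (bigD1 i) //= big1 ?addr0 => [|j ji].
    rewrite /peval mderivX mevalZ mnm1E eqxx mul1r.
    have -> : (mnm_sub (mnm1 i) (mnm1 i)) = mnm0 .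
      by apply/mnmP => k; rewrite mnmBE subnn mnm0E.
    by rewrite mpolyX0 meval1 mulr1.
  by rewrite /peval mderivX mevalZ mnm1E eq_sym (negPf ji) mul0r mulr0.
elim/mpolyind: p => [|c m p _ _ IH].
  by rewrite -mpolyC0; exact: Cst.
apply: D => //; rewrite -mul_mpolyC; apply: (M) => //.
rewrite mpolyXE_id; apply: (big_ind (fun q => is_diff x (peval q) (dpeval q x))).
- by rewrite -mpolyC1; exact: Cst.
- exact: M.
move=> i _; elim: (m i) => [|k IHk]; first by rewrite expr0 -mpolyC1; exact: Cst.
by rewrite exprS; exact: M.
Qed.

End Polynomials.
End DifferentialCalculus.

(** * Topology *)

Section ComplexTopology.
Variable R : realType.
Local Notation C := R[i].

Lemma Im_continuous : continuous (@complex.Im R : C -> R).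
Proof.
move=> x; apply/(@cvgrPdist_lt _ _ _ (nbhs (x : C))) => e e0.
have /(@cvgrPdist_lt _ _ _ (nbhs (x : C)))/(_ (e%:C)%C) :
  (fun y : C => y) @ x --> x by exact: cvg_id.
rewrite ltcR => /(_ e0); apply: filterS => y xy.
rewrite -ltcR; apply: le_lt_trans xy.
rewrite -raddfB normc_def lecR -sqrtr_sqr ler_wsqrtr // lerDr.
exact: sqr_ge0.
Qed.

Lemma real_complex_continuous : continuous (fun t : R => (t%:C)%C : C).
Proof.
(* In the order of [C], [0 < e] forces [e] to be real, so its real part serves as a radius in
   [R]. *)
move=> x; apply/cvgrPdist_lt => e; rewrite ltcE /= => /andP[/eqP e0 e1].
have /cvgrPdist_lt/(_ (complex.Re e) e1) : (fun y : R => y) @ x --> x.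
  exact: cvg_id.
apply: filterS => y xy; rewrite -rmorphB /= normc_def ltcE /= e0 eqxx /=.
by rewrite expr0n /= addr0 sqrtr_sqr.
Qed.

Lemma continuous_row (K : numFieldType) (T : topologicalType) n
    (f : T -> 'rV[K]_n) x :
  (forall j, {for x, continuous (fun y => f y 0 j : K)}) ->
  {for x, continuous f}.
Proof.
move=> cf; have -> : f = (fun y => \sum_j f y 0 j *: delta_mx 0 j).
  by apply/funext => y; rewrite [LHS]row_sum_delta.
apply: cvg_big => //; first exact: add_continuous.
by move=> j _; apply: cvgZr_tmp; exact: cf.
Qed.

Lemma map_Im_continuous n :
  continuous (fun Z : 'rV[C]_n => map_mx (@complex.Im R) Z).
Proof.
move=> Z; apply: continuous_row => j.
have -> : (fun y : 'rV[C]_n => map_mx (@complex.Im R) y 0 j) =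
    @complex.Im R \o (fun Z : 'rV[C]_n => Z 0 j).
  by apply/funext => y; rewrite mxE.
by apply: continuous_comp; [exact: coord_continuous | exact: Im_continuous].
Qed.

Lemma real_line_continuous (V : normedModType C) (z v : V) :
  continuous (fun t : R => z + (t%:C)%C *: v).
Proof.
move=> t; apply: cvgD; first exact: cvg_cst.
by apply: cvgZr_tmp; exact: real_complex_continuous.
Qed.

End ComplexTopology.

Section Connectedness.
Variable T : topologicalType.
Implicit Types A B : set T.

Lemma connected_componentP A :
  (forall x y, A x -> A y -> connected_component A x y) -> connected A.
Proof.
move=> H; have [[x Ax]|A0] := pselect (exists x, A x); last first.
  have -> : A = set0 by apply/seteqP; split => // x Ax; apply: A0; exists x.
  exact: connected0.
have -> : A = connected_component A x; last exact: component_connected.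
apply/seteqP; split => [y Ay|]; [exact: H | exact: connected_component_sub].
Qed.

Lemma connected_subset_component A B x y :
  connected B -> B `<=` A -> B x -> B y -> connected_component A x y.
Proof. by move=> cB BA Bx By; exists B. Qed.

Lemma curve_component (R : realType) A (c : R -> T) :
  continuous c -> (forall t, 0 <= t <= 1 -> A (c t)) ->
  connected_component A (c 0) (c 1).
Proof.
move=> cc cA; apply: (@connected_subset_component _ (c @` `[0, 1])).
- apply: connected_continuous_connected; first exact: segment_connected.
  exact: continuous_subspaceT.
- by move=> _ [t t01 <-]; apply: cA; move: t01; rewrite /= in_itv.
- by exists 0 => //=; rewrite in_itv /= lexx ler01.
- by exists 1 => //=; rewrite in_itv /= lexx ler01.
Qed.

End Connectedness.

(** * Cubic polynomials and their polar forms *)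

Section HomogeneousPolynomials.
Variables (K : numFieldType) (n : nat).
Implicit Types (p : mpoly n K) (x y z : 'rV[K]_n).

Lemma mderiv_dhomog d p i :
  p \is ishomog1 d.+1 mdeg -> mderiv i p \is ishomog1 d mdeg.
Proof.
move=> /dhomogP hp; apply/dhomogP => m.
rewrite mcoeff_msupp mcoeff_mderiv => pm.
have /hp : mnm_add m (mnm1 i) \in msupp p.
  by rewrite mcoeff_msupp; apply: contraNneq pm => ->; rewrite mul0rn.
move=> E; have := E : mdeg (mnm_add m (mnm1 i)) = d.+1.
by rewrite mdegD mdeg1 addn1 => -[].
Qed.

(** Monomial by monomial: differentiating in the [i]-th variable and multiplying by it multiplies a
    monomial by its [i]-th exponent, and the exponents add up to [d]. *)
Lemma euler_homogeneous d p x :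
  p \is ishomog1 d mdeg -> d%:R * peval p x = dpeval p x x.
Proof.
move=> /dhomogP hp; rewrite /dpeval.
have E i : mderiv i p = \sum_(m <- msupp p) mcoeff m p *: mderiv i (mpolyX K m).
  rewrite {1}(mpolyE p) (raddf_sum (mderiv i)); apply: eq_bigr => m _.
  exact: mderivZ.
transitivity (\sum_(i < n) \sum_(m <- msupp p)
    x 0 i * (mcoeff m p * meval (fun i => x 0 i) (mderiv i (mpolyX K m)))).
  rewrite exchange_big /= /peval mevalE mulr_sumr; apply: eq_big_seq => m mp.
  have <- : mdeg m = d by exact: hp.
  rewrite -mevalX [in LHS](mdegE m) natr_sum mulr_suml.
  apply: eq_bigr => i _.
  rewrite mderivX mevalZ [in RHS]mulrCA [in LHS]mulrCA; congr (_ * _).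
  (* Subtraction of exponents is truncated; for [m i = 0] the derivative has coefficient zero
     anyway. *)
  rewrite mulrCA; have [->|mi] := eqVneq (m i) 0%N; first by rewrite !mul0r.
  congr (_ * _); rewrite -[X in X * _](mevalXU (fun i => x 0 i)).
  rewrite -mevalM -mpolyXD; congr (meval _ (mpolyX _ _)).
  by apply/mnmP => j; rewrite mnmDE mnmBE mnm1E; case: eqP => [<-|] /=; lia.
apply: eq_bigr => i _; rewrite -mulr_sumr; congr (_ * _).
rewrite /peval E (raddf_sum (meval _)); apply: eq_bigr => m _.
by rewrite [RHS]mevalZ.
Qed.

Lemma dhomog0_peval p x y : p \is ishomog1 0 mdeg -> peval p x = peval p y.
Proof.
move=> /dhomogP hp; suff -> : p = mpolyC n (mcoeff mnm0 p).
  by rewrite /peval !mevalC.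
apply/mpolyP => m; rewrite mcoeffC.
have [<-|m0] := eqVneq mnm0 m; first by rewrite mulr1.
rewrite mulr0; apply/eqP; rewrite -[_ == 0]negbK -mcoeff_msupp.
by apply: contra m0 => /hp /eqP; rewrite mdeg_eq0 eq_sym.
Qed.

Section Cubic.
Variable h : mpoly n K.

(** Third derivatives of a cubic are constant, so the point [0] is arbitrary; dividing by [3! = 6]
    makes the diagonal of [cubic_polar] equal to [h]. Coefficients are used because they can be
    mapped into [C]. *)
Definition cubic_coef i j k : K :=
  peval (mderiv k (mderiv j (mderiv i h))) 0 / 6%:R.

Definition cubic_polar x y z : K :=
  \sum_i \sum_j \sum_k cubic_coef i j k * x 0 i * y 0 j * z 0 k.

Local Notation T := cubic_polar.

Lemma cubic_polarC12 x y z : T x y z = T y x z.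
Proof.
rewrite /T exchange_big; apply: eq_bigr => i _; apply: eq_bigr => j _.
apply: eq_bigr => k _; rewrite /cubic_coef (mderiv_comm j i).
by rewrite [_ * x 0 j * _]mulrAC.
Qed.

Lemma cubic_polarC23 x y z : T x y z = T x z y.
Proof.
rewrite /T; apply: eq_bigr => i _; rewrite exchange_big.
apply: eq_bigr => j _; apply: eq_bigr => k _.
by rewrite /cubic_coef (mderiv_comm j k) [_ * y 0 k * _]mulrAC.
Qed.

Lemma cubic_polarDr x y z z' : T x y (z + z') = T x y z + T x y z'.
Proof.
rewrite /T -big_split; apply: eq_bigr => i _; rewrite -big_split.
apply: eq_bigr => j _; rewrite -big_split; apply: eq_bigr => k _.
by rewrite mxE mulrDr.
Qed.

Lemma cubic_polarZr a x y z : T x y (a *: z) = a * T x y z.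
Proof.
rewrite /T mulr_sumr; apply: eq_bigr => i _; rewrite mulr_sumr.
apply: eq_bigr => j _; rewrite mulr_sumr; apply: eq_bigr => k _.
by rewrite mxE mulrCA.
Qed.

Lemma cubic_polarDm x y y' z : T x (y + y') z = T x y z + T x y' z.
Proof. by rewrite !(cubic_polarC23 x _ z) cubic_polarDr. Qed.

Lemma cubic_polarZm a x y z : T x (a *: y) z = a * T x y z.
Proof. by rewrite !(cubic_polarC23 x _ z) cubic_polarZr. Qed.

Lemma cubic_polarDl x x' y z : T (x + x') y z = T x y z + T x' y z.
Proof. by rewrite !(cubic_polarC12 _ y z) cubic_polarDm. Qed.

Lemma cubic_polarZl a x y z : T (a *: x) y z = a * T x y z.
Proof. by rewrite !(cubic_polarC12 _ y z) cubic_polarZm. Qed.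

Lemma cubic_polar_sumr x y z :
  T x y z = \sum_k z 0 k * T x y (delta_mx 0 k).
Proof.
rewrite {1}(row_sum_delta z); elim/big_rec2: _ => [|k a b _ <-].
  by rewrite -(scale0r (0 : 'rV_n)) cubic_polarZr mul0r.
by rewrite cubic_polarDr cubic_polarZr.
Qed.

Hypothesis h3 : h \is ishomog1 3 mdeg.

Lemma peval_mderiv3 i j k x :
  peval (mderiv k (mderiv j (mderiv i h))) x = 6%:R * cubic_coef i j k.
Proof.
rewrite /cubic_coef mulrC divfK ?pnatr_eq0 //.
by apply: dhomog0_peval; do 3!apply: mderiv_dhomog.
Qed.

(** Euler's relation for the second derivative, of degree 1, expresses it by the constant third
    ones. Repeating this in degrees 2 and 3 divides the factor 6 by 2 and then by 3, whence the
    factors 3 and 1 in the next two lemmas. *)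
Lemma peval_mderiv2 i j x :
  peval (mderiv j (mderiv i h)) x = 6%:R * T (delta_mx 0 i) (delta_mx 0 j) x.
Proof.
rewrite -[LHS]mul1r (@euler_homogeneous 1); last by do 2!apply: mderiv_dhomog.
rewrite /dpeval; under eq_bigr do rewrite peval_mderiv3.
rewrite cubic_polar_sumr mulr_sumr; apply: eq_bigr => k _.
rewrite mulrCA; congr (_ * (_ * _)).
(* Against basis vectors the triple sum collapses to the term with indices [i], [j], [k]. *)
rewrite /T (bigD1 i) //= [X in _ + X]big1 => [|i' i'i]; last first.
  rewrite big1 // => j' _; rewrite big1 // => k' _.
  by rewrite mxE eqxx (negPf i'i) !(mulr0, mul0r).
rewrite addr0 (bigD1 j) //= [X in _ + X]big1 => [|j' j'j]; last first.
  by rewrite big1 // => k' _; rewrite ![_ 0 j']mxE eqxx (negPf j'j) !(mulr0, mul0r).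
rewrite addr0 (bigD1 k) //= [X in _ + X]big1 => [|k' k'k]; last first.
  by rewrite ![_ 0 k']mxE eqxx (negPf k'k) !(mulr0, mul0r).
by rewrite addr0 !mxE !eqxx !mulr1.
Qed.

Lemma peval_mderiv1 i x :
  peval (mderiv i h) x = 3%:R * T x x (delta_mx 0 i).
Proof.
apply: (@mulfI _ (2%:R : K)); first by rewrite pnatr_eq0.
rewrite (@euler_homogeneous 2); last exact: mderiv_dhomog.
rewrite /dpeval; under eq_bigr do rewrite peval_mderiv2.
rewrite (cubic_polarC23 x x) (cubic_polarC12 x (delta_mx 0 i)).
under eq_bigr do rewrite cubic_polarC23 mulrCA.
by rewrite -mulr_sumr -cubic_polar_sumr mulrA -natrM.
Qed.

Lemma peval_cubic x : peval h x = T x x x.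
Proof.
apply: (@mulfI _ (3%:R : K)); first by rewrite pnatr_eq0.
rewrite (@euler_homogeneous 3) // /dpeval.
under eq_bigr do rewrite peval_mderiv1 mulrCA.
by rewrite -mulr_sumr -cubic_polar_sumr.
Qed.

Lemma dpeval_cubic x w : dpeval h x w = 3%:R * T x x w.
Proof.
rewrite /dpeval; under eq_bigr do rewrite peval_mderiv1 mulrCA.
by rewrite -mulr_sumr -cubic_polar_sumr.
Qed.

Lemma dpeval_mderiv_cubic i x w :
  dpeval (mderiv i h) x w = 6%:R * T x w (delta_mx 0 i).
Proof.
rewrite /dpeval; under eq_bigr do rewrite peval_mderiv2 mulrCA.
rewrite -mulr_sumr; congr (_ * _); rewrite cubic_polarC23 cubic_polar_sumr.
apply: eq_bigr => k _; congr (_ * _).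
by rewrite cubic_polarC23 cubic_polarC12 cubic_polarC23 cubic_polarC12 cubic_polarC23.
Qed.

End Cubic.
End HomogeneousPolynomials.

(** * The canonical metric of the tube domain *)

Section LineDerivative.
Variable K : numFieldType.

Lemma is_diff_line (V : normedModType K) (y w : V) (t : K) :
  is_diff t (fun t : K => y + t *: w) (fun t => t *: w).
Proof.
have [di diE] := is_diff_id (t : K).
have wd : is_diff t (fun s : K => s *: w) (fun s => s *: w).
  by apply: DiffDef; [exact: (differentiableZl (k := id)) | rewrite (diffZl (k := id)) ?diE].
by apply: is_diff_ext (is_diffD (is_diff_cst (y : V) t) wd) => s; rewrite !fctE ?add0r.
Qed.

Lemma is_derive_line (V W : normedModType K) (f df : V -> W) (y w : V) :
  is_diff y f df -> is_derive (0 : K) 1 (fun t : K => f (y + t *: w)) (df w).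
Proof.
move=> fdf.
have [dl dlE] : is_diff (0 : K) (fun t : K => f (y + t *: w)) (fun t => df (t *: w)).
  have fdf0 : is_diff (y + 0 *: w) f df by rewrite scale0r addr0.
  exact: (@is_diff_comp _ _ _ _ (fun t : K => y + t *: w) (fun t => t *: w)
    f df 0 (is_diff_line y w 0) fdf0).
apply: DeriveDef; first exact: diff_derivable.
by rewrite deriveE // dlE scale1r.
Qed.

Lemma is_diff0 (V W : normedModType K) (f df : V -> W) (y : V) :
  is_diff y f df -> df 0 = 0.
Proof. by move=> [_ <-]; rewrite linear0. Qed.

End LineDerivative.

Section RealDirections.
Variables (R : realType) (n : nat).
Local Notation C := R[i].
Local Notation Imx := (map_mx (@complex.Im R)).
Implicit Types (f : 'rV[C]_n -> C) (phi dphi : 'rV[R]_n -> R) (Z v : 'rV[C]_n).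

Lemma map_Im_line Z v (t : R) : Imx (Z + (t%:C)%C *: v) = Imx Z + t *: Imx v.
Proof.
apply/rowP => j; rewrite !mxE raddfD; congr (_ + _).
by case: (v 0 j) => a b /=; rewrite mul0r addr0.
Qed.

(** Along the line, [Im Z] moves with velocity [Im v]. The complex constant [c] is there so that the
    result of one Wirtinger derivative, which carries ['i / 2], can be differentiated again. *)
Lemma rdir_comp_Im c f phi dphi Z v :
  (\near Z, f Z = c * ((phi (Imx Z))%:C)%C) -> is_diff (Imx Z) phi dphi ->
  rderivable v f Z /\ rdir v f Z = c * ((dphi (Imx v))%:C)%C.
Proof.
move=> fphi phidphi.
have lf : \forall t \near (0 : R),
    f (Z + (t%:C)%C *: v) = c * ((phi (Imx Z + t *: Imx v))%:C)%C.
  have lc : (fun t : R => Z + (t%:C)%C *: v) @ (0 : R) --> Z.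
    have := @real_line_continuous R _ Z v 0.
    by rewrite /continuous_at scale0r addr0.
  have := lc _ fphi; rewrite /= => lfphi; near=> t.
  by rewrite -map_Im_line; near: t; exact: lfphi.
have gd := is_derive_line (Imx v) phidphi.
have dRe : is_derive (0 : R) 1 (fun t : R => complex.Re (f (Z + (t%:C)%C *: v)))
    (complex.Re c * dphi (Imx v)).
  have := is_deriveZ (complex.Re c) gd.
  apply: near_eq_is_derive; apply: filterS lf => t ->.
  by case: (c) => a b /=; rewrite mulr0 subr0.
have dIm : is_derive (0 : R) 1 (fun t : R => complex.Im (f (Z + (t%:C)%C *: v)))
    (complex.Im c * dphi (Imx v)).
  have := is_deriveZ (complex.Im c) gd.
  apply: near_eq_is_derive; apply: filterS lf => t ->.
  by case: (c) => a b /=; rewrite mulr0 add0r.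
split; first by split; [case: dRe | case: dIm].
rewrite /rdir !derive1E (@derive_val _ _ _ _ _ _ _ dRe) (@derive_val _ _ _ _ _ _ _ dIm).
by case: (c) => a b; apply/eqP; rewrite eq_complex /= !mulr0 subr0 add0r !eqxx.
Unshelve. all: by end_near. Qed.

Lemma map_Im_delta j : Imx (delta_mx 0 j : 'rV[C]_n) = 0.
Proof. by apply/rowP => k; rewrite !mxE; case: (_ && _). Qed.

Lemma map_Im_idelta j : Imx ('i *: delta_mx 0 j : 'rV[C]_n) = delta_mx 0 j.
Proof.
by apply/rowP => k; rewrite !mxE; case: (_ && _) => /=; rewrite ?mulr1 ?mulr0 ?add0r.
Qed.

(** Of the two directions in a Wirtinger derivative, the real one leaves [Im Z] fixed, and only ['i]
    times the basis vector contributes. *)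
Lemma dz_comp_Im c f phi dphi Z j :
  (\near Z, f Z = c * ((phi (Imx Z))%:C)%C) -> is_diff (Imx Z) phi dphi ->
  dz j f Z = - ('i / 2%:R) * c * ((dphi (delta_mx 0 j))%:C)%C /\
  dzbar j f Z = 'i / 2%:R * c * ((dphi (delta_mx 0 j))%:C)%C.
Proof.
move=> fphi phid; rewrite /dz /dzbar.
have [_ ->] := rdir_comp_Im (delta_mx 0 j) fphi phid.
have [_ ->] := rdir_comp_Im ('i *: delta_mx 0 j) fphi phid.
rewrite map_Im_delta map_Im_idelta (is_diff0 phid) mulr0.
by split; field.
Qed.

End RealDirections.

Section KahlerPotential.
Variables (R : realType) (n : nat) (h : mpoly n R).
Local Notation C := R[i].
Local Notation Imx := (map_mx (@complex.Im R)).
Variable U : set 'rV[C]_n.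
Hypothesis oU : open U.
Hypothesis hU : forall Z, U Z -> 0 < peval h (Imx Z).

Lemma is_diff_ln (V : normedModType R) (f df : V -> R) x :
  is_diff x f df -> 0 < f x ->
  is_diff x (fun y => ln (f y)) (fun w => df w / f x).
Proof.
move=> fdf fx0.
have [dl dlE] := is_derive1_ln fx0.
have [dl' dlE'] : is_diff (f x) (@ln R) (fun t => t / f x).
  have dl' : differentiable (@ln R) (f x) by apply/derivable1_diffP.
  apply: DiffDef => //; rewrite diff1E //; apply/funext => t.
  by rewrite derive1E dlE.
exact: (@is_diff_comp _ _ _ _ f df (@ln R) (fun t => t / f x) x).
Qed.

Lemma is_diff_quot (V : normedModType R) (f df g dg : V -> R) x :
  is_diff x f df -> is_diff x g dg -> g x != 0 ->
  is_diff x (fun y => f y / g y)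
    (fun w => (df w * g x - f x * dg w) / g x ^+ 2).
Proof.
move=> fdf gdg gx; apply: is_diff_ext (is_diff_mul fdf (is_diff_inv gdg gx)) => //.
by move=> y; field.
Qed.

Lemma dpeval_delta (p : mpoly n R) (Y : 'rV[R]_n) j :
  dpeval p Y (delta_mx 0 j) = peval (mderiv j p) Y.
Proof.
rewrite /dpeval (bigD1 j) //= big1 => [|i ij]; first by rewrite mxE !eqxx mul1r addr0.
by rewrite mxE (negPf ij) andbF mul0r.
Qed.

(** One quarter of the Hessian of [- 4/3 log h]; the quarter is the product of [- 'i / 2] and
    ['i / 2]. *)
Definition metric_coef (Y : 'rV[R]_n) (i j : 'I_n) : R :=
  - (peval (mderiv i (mderiv j h)) Y * peval h Y -
     peval (mderiv j h) Y * peval (mderiv i h) Y) / (3%:R * peval h Y ^+ 2).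

Lemma near_open (Q : 'rV[C]_n -> Prop) Z :
  U Z -> (forall Z', U Z' -> Q Z') -> \near Z, Q Z.
Proof. by move=> UZ QU; apply: filterS QU _; exact: open_nbhs_nbhs. Qed.

Lemma gcE Z i j : U Z -> gc h Z i j = ((metric_coef (Imx Z) i j)%:C)%C.
Proof.
move=> UZ; rewrite mxE.
have dzbE Z' : U Z' -> dzbar j (fun Z => ((kahler_potential h Z)%:C)%C) Z' =
    'i / 2%:R * (((- (4%:R / 3%:R) * (peval (mderiv j h) (Imx Z') / peval h (Imx Z')))%:C)%C).
  move=> UZ'.
  have phid := is_diffZ (- (4%:R / 3%:R)) (is_diff_ln (is_diff_peval h (Imx Z')) (hU UZ')).
  have fphi : \near Z', ((kahler_potential h Z')%:C)%C = 1 *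
      ((((- (4%:R / 3%:R)) *: (fun y => ln (peval h y)) : 'rV[R]_n -> R) (Imx Z'))%:C)%C.
    by near=> Z1; rewrite mul1r.
  have [_ ->] := dz_comp_Im j fphi phid.
  by rewrite mulr1 !fctE dpeval_delta.
have hn0 := lt0r_neq0 (hU UZ).
have phid := is_diffZ (- (4%:R / 3%:R)) (is_diff_quot (is_diff_peval (mderiv j h) (Imx Z))
  (is_diff_peval h (Imx Z)) hn0).
have [-> _] := dz_comp_Im i (near_open UZ dzbE) phid.
rewrite !fctE !dpeval_delta /metric_coef.
have -> : - ('i / 2%:R) * ('i / 2%:R) = ((4%:R^-1)%:C)%C :> C.
  by rewrite mulNr mulrACA -expr2 sqrCi fmorphV rmorph_nat; field.
rewrite -rmorphM; congr ((_)%:C)%C; rewrite /GRing.scale /=; field.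
exact: hn0.
Unshelve. all: by end_near. Qed.

(** A class that contains the coefficients of [gc] and is stable under every [rdir v], since the
    quotient rule turns the denominator [h ^+ k] into [h ^+ (k * 2)]. Smoothness then follows by
    induction on the list of directions. *)
Definition rational_in_Im (f : 'rV[C]_n -> C) :=
  exists (p : mpoly n R) (k : nat), forall Z, U Z ->
    f Z = ((peval p (Imx Z) / peval (h ^+ k) (Imx Z))%:C)%C.

Lemma peval_expn (p : mpoly n R) k Y : peval (p ^+ k) Y = peval p Y ^+ k.
Proof.
elim: k => [|k IH]; first by rewrite !expr0 /peval meval1.
by rewrite !exprS -IH /peval mevalM.
Qed.

Lemma rational_in_Im_diff f (p : mpoly n R) k v :
  (forall Z, U Z -> f Z = ((peval p (Imx Z) / peval (h ^+ k) (Imx Z))%:C)%C) ->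
  (forall Z, U Z -> rderivable v f Z) /\ rational_in_Im (rdir v f).
Proof.
move=> fE.
have D Z : U Z -> rderivable v f Z /\ rdir v f Z =
    (((dpeval p (Imx Z) (Imx v) * peval (h ^+ k) (Imx Z) - peval p (Imx Z) *
     dpeval (h ^+ k) (Imx Z) (Imx v)) / peval (h ^+ k) (Imx Z) ^+ 2)%:C)%C.
  move=> UZ.
  have hk0 : peval (h ^+ k) (Imx Z) != 0.
    by rewrite peval_expn expf_neq0 // lt0r_neq0 // hU.
  have phid := is_diff_quot (is_diff_peval p (Imx Z)) (is_diff_peval (h ^+ k) (Imx Z)) hk0.
  have fphi : \near Z, f Z = 1 *
      (((fun y => peval p y / peval (h ^+ k) y) (Imx Z))%:C)%C.
    by apply: near_open => // Z' UZ'; rewrite mul1r fE.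
  by have := rdir_comp_Im v fphi phid; rewrite mul1r.
split; first by move=> Z /D [].
have dE (q : mpoly n R) Y : dpeval q Y (Imx v) =
    peval (\sum_i (Imx v) 0 i *: mderiv i q) Y.
  rewrite /peval (raddf_sum (meval _)); apply: eq_bigr => i _.
  by rewrite [RHS]mevalZ.
exists ((\sum_i (Imx v) 0 i *: mderiv i p) * h ^+ k -
        p * (\sum_i (Imx v) 0 i *: mderiv i (h ^+ k))), (k * 2)%N => Z UZ.
have [_ ->] := D Z UZ; rewrite !dE exprM [in RHS]peval_expn.
by rewrite {5 6}/peval mevalB !mevalM.
Qed.

Lemma rational_in_Im_continuous f Z :
  rational_in_Im f -> U Z -> {for Z, continuous f}.
Proof.
move=> [p [k fE]] UZ.
pose g := real_complex R \o (fun Y => peval p Y / peval (h ^+ k) Y) \o Imx.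
have cg : {for Z, continuous g}.
  apply: continuous_comp; first exact: map_Im_continuous.
  apply: continuous_comp; last exact: real_complex_continuous.
  have hk0 : peval (h ^+ k) (Imx Z) != 0.
    by rewrite peval_expn expf_neq0 // lt0r_neq0 // hU.
  apply: differentiable_continuous.
  by have [] := is_diff_quot (is_diff_peval p (Imx Z)) (is_diff_peval (h ^+ k) (Imx Z)) hk0.
have fg : \near Z, g Z = f Z by apply: near_open => // Z' /fE ->.
have fgZ : g Z = f Z := nbhs_singleton fg.
have cgZ : g @ Z --> g Z := cg; rewrite fgZ in cgZ.
by apply: cvg_trans cgZ; exact: (near_eq_cvg fg).
Qed.

Lemma rational_in_Im_smooth f : rational_in_Im f -> smooth_on U f.
Proof.
move=> rf vs Z UZ; have rfv : rational_in_Im (foldr (@rdir R n) f vs).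
  elim: vs => [//|v vs [p [k fE]]] /=.
  by have [_] := rational_in_Im_diff v fE.
split; first exact: rational_in_Im_continuous.
by move=> v; have [p [k fE]] := rfv; have [+ _] := rational_in_Im_diff v fE; apply.
Qed.

Lemma gc_smooth i j : smooth_on U (fun Z => gc h Z i j).
Proof.
apply: rational_in_Im_smooth.
exists (- 3%:R^-1 *: (mderiv i (mderiv j h) * h - mderiv j h * mderiv i h)), 2%N => Z UZ.
rewrite gcE // /metric_coef; congr ((_)%:C)%C.
rewrite peval_expn /peval [in RHS]mevalZ mevalB !mevalM.
by field; rewrite lt0r_neq0 // hU.
Qed.

Lemma gc_closed Z i j k : U Z ->
  dz k (fun Z' => gc h Z' i j) Z = dz i (fun Z' => gc h Z' k j) Z.
Proof.
move=> UZ; have hn0 := lt0r_neq0 (hU UZ).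
(* Quotient rule for a second logarithmic derivative. The first fraction is not symmetric in [i']
   and [k']; symmetry appears only when the two fractions are combined and the common factor [h] is
   cancelled. *)
have E i' k' : dz k' (fun Z' => gc h Z' i' j) Z = - ('i / 2%:R) *
   ((- ((peval (mderiv k' (mderiv i' (mderiv j h))) (Imx Z) * peval h (Imx Z) +
         peval (mderiv i' (mderiv j h)) (Imx Z) * peval (mderiv k' h) (Imx Z) -
         peval (mderiv k' (mderiv j h)) (Imx Z) * peval (mderiv i' h) (Imx Z) -
         peval (mderiv j h) (Imx Z) * peval (mderiv k' (mderiv i' h)) (Imx Z)) /
        (3%:R * peval h (Imx Z) ^+ 2)
     - 2%:R * (peval (mderiv i' (mderiv j h)) (Imx Z) * peval h (Imx Z) -
       peval (mderiv j h) (Imx Z) * peval (mderiv i' h) (Imx Z)) * peval (mderiv k' h) (Imx Z) /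
        (3%:R * peval h (Imx Z) ^+ 3)))%:C)%C.
  set p := - (mderiv i' (mderiv j h) * h - mderiv j h * mderiv i' h).
  set q := 3%:R *: h ^+ 2.
  have pE Y : peval p Y = - (peval (mderiv i' (mderiv j h)) Y * peval h Y -
     peval (mderiv j h) Y * peval (mderiv i' h) Y).
    by rewrite /peval /p mevalN mevalB !mevalM.
  have qE Y : peval q Y = 3%:R * peval h Y ^+ 2.
    by rewrite -peval_expn /peval /q [LHS]mevalZ.
  have q0 : peval q (Imx Z) != 0 by rewrite qE mulf_neq0 ?expf_neq0 ?pnatr_eq0.
  have phid := is_diff_quot (is_diff_peval p (Imx Z)) (is_diff_peval q (Imx Z)) q0.
  have fphi : \near Z, gc h Z i' j = 1 * (((fun Y => peval p Y / peval q Y) (Imx Z))%:C)%C.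
    by apply: near_open => // Z' UZ'; rewrite mul1r gcE // pE qE.
  have [-> _] := dz_comp_Im k' fphi phid.
  rewrite mulr1 !dpeval_delta; congr (_ * ((_)%:C)%C).
  rewrite qE pE /p /q mderivN mderivB !mderivM mderivZ expr2 mderivM.
  rewrite /peval mevalN mevalB !mevalD [meval _ (_ *: _)]mevalZ !mevalD !mevalM.
  by field.
rewrite !E (mderiv_comm k i (mderiv j h)) (mderiv_comm k i h).
by congr (_ * ((_)%:C)%C); field.
Qed.

End KahlerPotential.

(** * The prepotential and the form gamma *)

Section MapPolynomials.
Variables (K L : numFieldType) (f : {rmorphism K -> L}) (n : nat).
Implicit Types (p : mpoly n K).

Lemma mderiv_map_mpoly p i : mderiv i (map_mpoly f p) = map_mpoly f (mderiv i p).
Proof.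
by apply/mpolyP => m; rewrite mcoeff_mderiv !mcoeff_map_mpoly mcoeff_mderiv raddfMn.
Qed.

Lemma peval_map_mpoly p x : peval (map_mpoly f p) (map_mx f x) = f (peval p x).
Proof.
rewrite /peval; elim/mpolyind: p => [|c m p _ _ IH].
  by rewrite raddf0 !meval0 rmorph0.
rewrite raddfD !mevalD rmorphD IH; congr (_ + _).
rewrite /= map_mpolyZ map_mpolyX !mevalZ !mevalX rmorphM rmorph_prod.
by congr (_ * _); apply: eq_bigr => i _; rewrite mxE rmorphXn.
Qed.

Lemma dhomog_map_mpoly d p :
  p \is ishomog1 d mdeg -> map_mpoly f p \is ishomog1 d mdeg.
Proof.
move=> /dhomogP hp; apply/dhomogP => m; rewrite mcoeff_msupp mcoeff_map_mpoly => fp.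
apply: hp; rewrite mcoeff_msupp; apply: contraNneq fp => ->; by rewrite raddf0.
Qed.

Lemma cubic_coef_map (h : mpoly n K) i j k :
  cubic_coef (map_mpoly f h) i j k = f (cubic_coef h i j k).
Proof.
rewrite /cubic_coef !mderiv_map_mpoly fmorph_div rmorph_nat -peval_map_mpoly.
by congr (peval _ _ / _); apply/rowP => l; rewrite !mxE rmorph0.
Qed.

Lemma cubic_polar_map (h : mpoly n K) x y z :
  cubic_polar (map_mpoly f h) (map_mx f x) (map_mx f y) (map_mx f z) =
  f (cubic_polar h x y z).
Proof.
rewrite /cubic_polar rmorph_sum; apply: eq_bigr => i _.
rewrite rmorph_sum; apply: eq_bigr => j _; rewrite rmorph_sum; apply: eq_bigr => k _.
by rewrite cubic_coef_map !rmorphM !mxE.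
Qed.

End MapPolynomials.

Section RowOfForm.
Variables (K : numFieldType) (m : nat).

Lemma linear_row_sum (f : 'rV[K]_m -> K) (w : 'rV[K]_m) :
  (forall a x y, f (a *: x + y) = a * f x + f y) ->
  \sum_j f (delta_mx 0 j) * w 0 j = f w.
Proof.
move=> fl; have f0 : f 0 = 0.
  by apply: (@addrI _ (1 * f 0)); rewrite -fl scaler0 addr0 mul1r addr0.
rewrite [in RHS](row_sum_delta w); elim/big_rec2: _ => [//|j a b _ ->].
by rewrite fl mulrC.
Qed.

End RowOfForm.

Section PolarIdentities.
Variables (K : numFieldType) (n : nat) (h : mpoly n K) (i : K).
Hypothesis ii : i * i = -1.
Local Notation T := (cubic_polar h).
Implicit Types X Y x y : 'rV[K]_n.

(** [Zb] stands for the conjugate of [Z], so that the identities become polynomial in [i]. As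
    [Z - Zb] is [2 i Y], the constants of the three lemmas are [i (2 i)^3 = 8],
    [- 3 i (2 i)^2 = 12 i] and [- 6 i (2 i) = 12]. *)
Lemma polar_lift X Y (Z := X + i *: Y) (Zb := X + (- i) *: Y) :
  i * (3%:R * T Zb Zb Z - T Zb Zb Zb - (3%:R * T Z Z Zb - T Z Z Z)) =
  8%:R * T Y Y Y.
Proof.
rewrite /Z /Zb !cubic_polarDl !cubic_polarDm !cubic_polarDr.
rewrite !cubic_polarZl !cubic_polarZm !cubic_polarZr.
rewrite (cubic_polarC23 _ Y Y X) !(cubic_polarC12 _ Y X) (cubic_polarC23 _ X Y X).
by ring: ii.
Qed.

Lemma polar_lift_tan X Y y (Z := X + i *: Y) (Zb := X + (- i) *: Y) :
  i * (6%:R * T Zb y Z - 3%:R * T Zb Zb y - 3%:R * T Z Z y) =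
  12%:R * i * T Y Y y.
Proof.
rewrite /Z /Zb !cubic_polarDl !cubic_polarDm !cubic_polarDr.
rewrite !cubic_polarZl !cubic_polarZm !cubic_polarZr.
rewrite !(cubic_polarC23 _ _ y) !(cubic_polarC12 _ Y X).
by ring: ii.
Qed.

Lemma polar_tan X Y x y (Z := X + i *: Y) (Zb := X + (- i) *: Y) :
  i * (6%:R * T Zb y x - 6%:R * T Z x y) = 12%:R * T Y x y.
Proof.
rewrite /Z /Zb !cubic_polarDl !cubic_polarZl !(cubic_polarC23 _ _ y x).
by ring: ii.
Qed.

End PolarIdentities.

Section Prepotential.
Variables (R : realType) (n : nat) (h : mpoly n R).
Hypothesis h3 : h \is ishomog1 3 mdeg.
Local Notation C := R[i].
Local Notation V := ('rV[C]_(1 + n) * 'rV[C]_(1 + n))%type.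
Local Notation hC := (map_mpoly (real_complex R) h : mpoly n C).
Local Notation T := (cubic_polar hC).
Implicit Types (z : 'rV[C]_(1 + n)) (Z X Y : 'rV[C]_n).

Let hC3 : hC \is ishomog1 3 mdeg.
Proof. exact: dhomog_map_mpoly. Qed.

Local Notation z0 z := ((z : 'rV[C]_(1 + n)) 0 (lshift n (ord0 : 'I_1))).

(** The differential of the prepotential at [z] and, in [hess], its second derivative, by the
    quotient rule. [pot_row] and [hess_row] are the rows of their coefficients, that is, fibre
    coordinates in the cotangent space. *)
Definition dprep z w : C :=
  3%:R * T (rsubmx z) (rsubmx z) (rsubmx w) / z0 z -
  T (rsubmx z) (rsubmx z) (rsubmx z) * z0 w / z0 z ^+ 2.

Definition hess z v w : C :=
  6%:R * T (rsubmx z) (rsubmx v) (rsubmx w) / z0 z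
  - 3%:R * T (rsubmx z) (rsubmx z) (rsubmx w) * z0 v / z0 z ^+ 2
  - 3%:R * T (rsubmx z) (rsubmx z) (rsubmx v) * z0 w / z0 z ^+ 2
  + 2%:R * T (rsubmx z) (rsubmx z) (rsubmx z) * z0 v * z0 w / z0 z ^+ 3.

Lemma dprep_linear z a v w : dprep z (a *: v + w) = a * dprep z v + dprep z w.
Proof.
rewrite /dprep linearP /= cubic_polarDr cubic_polarZr !mxE.
by rewrite !mulrDl !mulrDr !mulrDl; ring.
Qed.

Lemma hess_linear z v a w w' : hess z v (a *: w + w') = a * hess z v w + hess z v w'.
Proof.
by rewrite /hess linearP /= !cubic_polarDr !cubic_polarZr !mxE; ring.
Qed.

Lemma hess_sym z v w : hess z v w = hess z w v.
Proof. by rewrite /hess (cubic_polarC23 _ _ (rsubmx v)); ring. Qed.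

Definition pot_row z : 'rV[C]_(1 + n) := \row_j dprep z (delta_mx 0 j).
Definition hess_row z w : 'rV[C]_(1 + n) := \row_j hess z w (delta_mx 0 j).

Lemma pot_row_sum z (w : 'rV[C]_(1 + n)) : \sum_j pot_row z 0 j * w 0 j = dprep z w.
Proof.
under eq_bigr do rewrite mxE; apply: linear_row_sum => *; exact: dprep_linear.
Qed.

Lemma hess_row_sum z v (w : 'rV[C]_(1 + n)) : \sum_j hess_row z v 0 j * w 0 j = hess z v w.
Proof.
under eq_bigr do rewrite mxE; apply: linear_row_sum => *; exact: hess_linear.
Qed.

(** Up to the factor 3, [T y y w] is the derivative of the cubic at [y] along [w], so it is a
    combination of first partial derivatives, which are polynomials. *)
Lemma is_diff_polar2 (x w : 'rV[C]_n) :
  is_diff x (fun y : 'rV[C]_n => T y y w : C) (fun v : 'rV[C]_n => 2%:R * T x v w).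
Proof.
have H k : is_diff x (fun y : 'rV[C]_n => w 0 k / 3%:R * peval (mderiv k hC) y)
    (fun v => w 0 k / 3%:R * dpeval (mderiv k hC) x v).
  exact: is_diffZ (is_diff_peval (mderiv k hC) x).
apply: is_diff_ext (is_diff_sum H) => y.
  rewrite cubic_polar_sumr; apply: eq_bigr => k _.
  by rewrite peval_mderiv1 //; field.
rewrite cubic_polar_sumr mulr_sumr; apply: eq_bigr => k _.
by rewrite dpeval_mderiv_cubic //; field.
Qed.

Lemma is_diff_polar3 (x : 'rV[C]_n) :
  is_diff x (fun y : 'rV[C]_n => T y y y : C) (fun v : 'rV[C]_n => 3%:R * T x x v).
Proof.
apply: is_diff_ext (is_diff_peval hC x) => y; first by rewrite peval_cubic.
by rewrite dpeval_cubic.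
Qed.

Lemma is_diff_rsubmx z :
  is_diff z (rsubmx : 'rV[C]_(1 + n) -> 'rV[C]_n) rsubmx.
Proof.
apply: is_diff_row => j.
by apply: is_diff_ext (is_diff_coord z 0 (rshift 1 j)) => y; rewrite mxE.
Qed.

Lemma is_diff_prepotential z : z0 z != 0 -> is_diff z (prepotential h) (dprep z).
Proof.
move=> z00.
have d1 : is_diff z (fun y : 'rV[C]_(1 + n) => T (rsubmx y) (rsubmx y) (rsubmx y) : C)
    (fun v => 3%:R * T (rsubmx z) (rsubmx z) (rsubmx v)).
  exact: (@is_diff_comp _ _ _ _ _ _ _ _ z (is_diff_rsubmx z) (is_diff_polar3 (rsubmx z))).
have d2 := is_diff_inv (is_diff_coord z 0 (lshift n ord0)) z00.
apply: is_diff_ext (is_diff_mul d1 d2) => y.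
  rewrite /prepotential -/(peval hC (rsubmx y)) peval_cubic //; congr (_ / _).
  by rewrite mxE; congr (y _ _); apply/val_inj.
by rewrite /dprep; field.
Qed.

Lemma dgraphE z : z0 z != 0 -> dgraph (prepotential h) z = (z, pot_row z).
Proof.
move=> z00; congr (_, _); apply/rowP => j; rewrite !mxE.
have [d dE] := is_diff_prepotential z00.
by rewrite deriveE // dE.
Qed.

Lemma is_diff_dprep z w : z0 z != 0 ->
  is_diff z (fun y => dprep y w : C) (fun v => hess z v w).
Proof.
move=> z00.
have d1 : is_diff z (fun y : 'rV[C]_(1 + n) => T (rsubmx y) (rsubmx y) (rsubmx y) : C)
    (fun v => 3%:R * T (rsubmx z) (rsubmx z) (rsubmx v)).
  exact: (@is_diff_comp _ _ _ _ _ _ _ _ z (is_diff_rsubmx z) (is_diff_polar3 (rsubmx z))).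
have d2 : is_diff z (fun y : 'rV[C]_(1 + n) => T (rsubmx y) (rsubmx y) (rsubmx w) : C)
    (fun v => 2%:R * T (rsubmx z) (rsubmx v) (rsubmx w)).
  exact: (@is_diff_comp _ _ _ _ _ _ _ _ z (is_diff_rsubmx z)
    (is_diff_polar2 (rsubmx z) (rsubmx w))).
have d0 := is_diff_inv (is_diff_coord z 0 (lshift n ord0)) z00.
have e1 := is_diffZ (3%:R : C) (is_diff_mul d2 d0).
have e2 := is_diffZ (z0 w) (is_diff_mul d1 (is_diff_mul d0 d0)).
apply: is_diff_ext (is_diffB e1 e2) => y; rewrite /dprep /hess !fctE /GRing.scale /=.
  by rewrite expr2 invfM; ring.
by field.
Qed.

Lemma near_z0_neq0 z : z0 z != 0 -> \forall y \near z, z0 (y : 'rV[C]_(1 + n)) != 0.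
Proof.
move=> z00.
have c : (fun y : 'rV[C]_(1 + n) => z0 y : C) @ z --> (z0 z : C).
  exact: coord_continuous.
exact: (cvgr_neq0 _ c z00).
Qed.

(** [dgraph] is made of directional derivatives, known to agree with [pot_row] where [z0] is
    nonzero; this set is open, which suffices for the differential. *)
Lemma is_diff_dgraph z : z0 z != 0 ->
  is_diff z (dgraph (prepotential h)) (fun w => (w, hess_row z w)).
Proof.
move=> z00.
apply: (@near_eq_is_diff _ _ _ (fun y => (y, pot_row y))).
  by apply: filterS (near_z0_neq0 z00) => y y0; rewrite dgraphE.
apply: is_diff_pair; apply: is_diff_row => j.
apply: is_diff_ext (is_diff_dprep (delta_mx 0 j) z00) => y; by rewrite mxE.
Qed.

Lemma pot_rowZ a z : a != 0 -> z0 z != 0 -> pot_row (a *: z) = a *: pot_row z.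
Proof.
move=> a0 z00; apply/rowP => j; rewrite !mxE /dprep linearZ /=.
rewrite !(cubic_polarZl, cubic_polarZm, cubic_polarZr) [(a *: z) _ _]mxE; field.
by rewrite a0 z00.
Qed.

(** Second derivatives of a function homogeneous of degree 2 have degree 0: the tangent space of the
    cone does not change along a complex line. *)
Lemma hess_rowZ a z w : a != 0 -> z0 z != 0 -> hess_row (a *: z) w = hess_row z w.
Proof.
move=> a0 z00; apply/rowP => j; rewrite !mxE /hess linearZ /=.
rewrite !(cubic_polarZl, cubic_polarZm, cubic_polarZr) [(a *: z) _ _]mxE; field.
by rewrite a0 z00.
Qed.

Lemma omega_hess_row z v w :
  omega (v, hess_row z v) (w, hess_row z w) = 0.
Proof.
rewrite /omega /= big_split /= sumrN hess_row_sum.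
under eq_bigr do rewrite mulrC.
by rewrite hess_row_sum hess_sym subrr.
Qed.

(** Pairing with the tangent vector over the [j]-th basis vector isolates the [j]-th fibre
    coordinate of [v]. This is the maximality half of the Lagrangean property. *)
Lemma omega_hess_row_eq z (v : V) :
  (forall w, omega v (w, hess_row z w) = 0) -> v = (v.1, hess_row z v.1).
Proof.
move=> H; case: v H => a b H /=; congr (_, _); apply/rowP => j.
have := H (delta_mx 0 j); rewrite /omega /= big_split /= sumrN.
under eq_bigr do rewrite mulrC.
rewrite hess_row_sum hess_sym mxE => /subr0_eq ->.
rewrite (bigD1 j) //= big1 ?addr0 => [|k kj]; first by rewrite mxE !eqxx mulr1.
by rewrite mxE (negPf kj) andbF mulr0.
Qed.

Local Notation conjv := (map_mx (@Num.conj C)).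

Lemma gamma_hess z v w : gamma (v, hess_row z v) (w, hess_row z w) =
  'i * ((hess z w (conjv v))^* - hess z v (conjv w)).
Proof.
rewrite /gamma /omega /= big_split /= sumrN; congr (_ * (_ - _)); last first.
  by rewrite hess_row_sum.
rewrite -hess_row_sum rmorph_sum; apply: eq_bigr => j _.
by rewrite rmorphM /= !mxE conjCK mulrC.
Qed.

Lemma gamma_pot_hess z w : gamma (z, pot_row z) (w, hess_row z w) =
  'i * ((hess z w (conjv z))^* - dprep z (conjv w)).
Proof.
rewrite /gamma /omega /= big_split /= sumrN; congr (_ * (_ - _)); last first.
  by rewrite pot_row_sum.
rewrite -hess_row_sum rmorph_sum; apply: eq_bigr => j _.
by rewrite rmorphM /= !mxE conjCK mulrC.
Qed.

Lemma gamma_pot z : gamma (z, pot_row z) (z, pot_row z) =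
  'i * ((dprep z (conjv z))^* - dprep z (conjv z)).
Proof.
rewrite /gamma /omega /= big_split /= sumrN; congr (_ * (_ - _)); last first.
  by rewrite pot_row_sum.
rewrite -pot_row_sum rmorph_sum; apply: eq_bigr => j _.
by rewrite rmorphM /= !mxE conjCK mulrC.
Qed.

Lemma conj_real_complex (x : R) : ((x%:C)%C : C)^* = (x%:C)%C.
Proof. by apply/eqP; rewrite eq_complex /= oppr0 !eqxx. Qed.

Lemma cubic_polar_conj X Y Z : (T X Y Z)^* = T (conjv X) (conjv Y) (conjv Z).
Proof.
rewrite /cubic_polar rmorph_sum; apply: eq_bigr => i _.
rewrite rmorph_sum; apply: eq_bigr => j _; rewrite rmorph_sum; apply: eq_bigr => k _.
rewrite 3!rmorphM !mxE cubic_coef_map /=; congr (_ * _ * _ * _).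
exact: conj_real_complex.
Qed.

Local Notation Imc Z := (map_mx (real_complex R) (map_mx (@complex.Im R) Z) : 'rV[C]_n).
Local Notation Rec Z := (map_mx (real_complex R) (map_mx (@complex.Re R) Z) : 'rV[C]_n).

Lemma row_ReIm Z : Z = Rec Z + 'i *: Imc Z.
Proof. by apply/rowP => j; rewrite !mxE [LHS]complexE. Qed.

Lemma row_conj_ReIm Z : conjv Z = Rec Z - 'i *: Imc Z.
Proof.
apply/rowP => j; rewrite !mxE; case: (Z 0 j) => a b; apply/eqP.
by rewrite eq_complex /= !(mul0r, mulr0, mul1r, subr0, add0r, addr0, oppr0) !eqxx.
Qed.

Local Notation aff Z := (row_mx 1%:M Z : 'rV[C]_(1 + n)).
Local Notation tan w := (row_mx 0 w : 'rV[C]_(1 + n)).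

Lemma z0_aff Z : z0 (aff Z) = 1.
Proof. by rewrite row_mxEl mxE. Qed.

Lemma z0_tan Z : z0 (tan Z) = 0.
Proof. by rewrite row_mxEl mxE. Qed.

Lemma conj_aff Z : conjv (aff Z) = aff (conjv Z).
Proof. by rewrite map_row_mx map_mx1. Qed.

Lemma conj_tan Z : conjv (tan Z) = tan (conjv Z).
Proof. by rewrite map_row_mx map_mx0. Qed.

Definition affE := (z0_aff, z0_tan, conj_aff, conj_tan, row_mxKr).

Lemma sqr_i : 'i * 'i = -1 :> C.
Proof. by rewrite -expr2 sqrCi. Qed.

Lemma conjvK Z : conjv (conjv Z) = Z.
Proof. by apply/rowP => j; rewrite !mxE conjCK. Qed.

(** As [z0 = 1] on [aff Z], the denominators disappear, and since the coefficients are real,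
    conjugation acts on the arguments only; [polar_lift] then applies to the real and imaginary
    parts of [Z]. The next two lemmas also use [z0 = 0] on [tan]. *)
Lemma gamma_lift Z : gamma (aff Z, pot_row (aff Z)) (aff Z, pot_row (aff Z)) =
  8%:R * T (Imc Z) (Imc Z) (Imc Z).
Proof.
rewrite gamma_pot /dprep !affE !expr1n !divr1 !mulr1 rmorphB rmorphM rmorph_nat /=.
rewrite !cubic_polar_conj conjvK -(polar_lift _ sqr_i (Rec Z)) -row_ReIm.
by rewrite scaleNr -row_conj_ReIm.
Qed.

Lemma gamma_lift_tan Z y :
  gamma (aff Z, pot_row (aff Z)) (tan y, hess_row (aff Z) (tan y)) =
  12%:R * 'i * T (Imc Z) (Imc Z) (conjv y).
Proof.
rewrite gamma_pot_hess /dprep /hess !affE !expr1n !divr1 !mulr1 !mulr0 ?mul0r ?subr0 ?addr0.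
rewrite rmorphB !rmorphM !rmorph_nat /=.
rewrite !cubic_polar_conj conjvK -(polar_lift_tan _ sqr_i (Rec Z)) -row_ReIm.
by rewrite scaleNr -row_conj_ReIm.
Qed.

Lemma gamma_tan Z x y :
  gamma (tan x, hess_row (aff Z) (tan x)) (tan y, hess_row (aff Z) (tan y)) =
  12%:R * T (Imc Z) x (conjv y).
Proof.
rewrite gamma_hess /hess !affE !expr1n !divr1 !mulr0 ?mul0r ?subr0 ?addr0.
rewrite rmorphM rmorph_nat /=.
rewrite !cubic_polar_conj conjvK -(polar_tan _ sqr_i (Rec Z)) -row_ReIm.
by rewrite scaleNr -row_conj_ReIm.
Qed.

Lemma affine_liftE Z : affine_lift h Z = (aff Z, pot_row (aff Z)).
Proof. by rewrite /affine_lift dgraphE // z0_aff oner_neq0. Qed.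

Lemma is_diff_affine_lift Z :
  is_diff Z (affine_lift h) (fun w : 'rV[C]_n => (tan w, hess_row (aff Z) (tan w))).
Proof.
have d1 : is_diff Z (fun Z : 'rV[C]_n => aff Z) (fun w : 'rV[C]_n => tan w).
  apply: is_diff_row => j; case: (fintype.split_ordP j) => k ->.
    apply: is_diff_ext (is_diff_cst ((1%:M : 'M[C]_1) 0 k : C) Z) => y.
      by rewrite row_mxEl.
    by rewrite row_mxEl mxE.
  by apply: is_diff_ext (is_diff_coord Z 0 k) => y; rewrite row_mxEr.
have z01 : z0 (aff Z) != 0 by rewrite z0_aff oner_neq0.
exact: (@is_diff_comp _ _ _ _ _ _ _ _ Z d1 (is_diff_dgraph z01)).
Qed.

End Prepotential.

Section GammaForm.
Variables (R : realType) (m : nat).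
Local Notation C := R[i].
Local Notation V := ('rV[C]_(1 + m) * 'rV[C]_(1 + m))%type.
Implicit Types u v w : V.

Lemma gamma_linear a u v w : gamma (a *: u + v) w = a * gamma u w + gamma v w.
Proof.
rewrite /gamma mulrCA -mulrDr; congr (_ * _).
rewrite /omega mulr_sumr -big_split; apply: eq_bigr => j _ /=.
by rewrite !mxE; ring.
Qed.

Lemma gamma_conj u v : (gamma u v)^* = gamma v u.
Proof.
rewrite /gamma rmorphM /= conjCi mulNr -mulrN; congr (_ * _).
rewrite /omega rmorph_sum -sumrN; apply: eq_bigr => j _ /=.
by rewrite !mxE rmorphB !rmorphM /= !conjCK; ring.
Qed.

Lemma gamma_linearr a u v w : gamma w (a *: u + v) = a^* * gamma w u + gamma w v.
Proof.
by rewrite -gamma_conj gamma_linear rmorphD rmorphM /= !gamma_conj.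
Qed.

Lemma gammaZ a u v : gamma (a *: u) v = a * gamma u v.
Proof.
have := gamma_linear a u 0 v; rewrite addr0 => ->.
suff -> : gamma 0 v = 0 by rewrite addr0.
by rewrite /gamma /omega big1 ?mulr0 // => j _; rewrite !mxE !mul0r subrr.
Qed.

Lemma gammaZr a u v : gamma u (a *: v) = a^* * gamma u v.
Proof. by rewrite -gamma_conj gammaZ rmorphM /= gamma_conj. Qed.

(** Projective invariance: differentiating a rescaled lift [a u] gives [a v + b u]. The subtracted
    square removes the component along [u], and the factor [a a^*] cancels in the quotients. *)
Lemma special_metric_scale a b u v : a != 0 -> gamma u u != 0 ->
  special_metric (a *: u) (a *: v + b *: u) = special_metric u v.
Proof.
move=> a0 u0; rewrite /special_metric; congr (_ * _).
rewrite !normCK !gamma_linear !gamma_linearr !gammaZ !gammaZr.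
have := gamma_conj u v; have := gamma_conj u u.
(* A scalar and its conjugate become independent unknowns for [field]; what remains of Hermitian
   symmetry is that [p] is real and [r] is the conjugate of [q]. *)
move: u0; generalize (gamma u u) (gamma u v) (gamma v u) (gamma v v).
move=> p q r s p0 pJ qJ.
rewrite !(rmorphM, rmorphD, fmorphV) /= !conjCK pJ -qJ.
by field; rewrite p0 a0 conjC_eq0 a0.
Qed.

End GammaForm.

(** * The metric of the tube as a bilinear form *)

Section MetricForm.
Variables (K : numFieldType) (n : nat) (h : mpoly n K).
Local Notation T := (cubic_polar h).
Implicit Types Y x y : 'rV[K]_n.

(** Kept bilinear over any field: over [R] it carries nondegeneracy and signature, and over [C] the
    Hermitian metric arises by inserting a conjugate in the last argument. *)
Definition metric_form Y x y : K :=
  - 2%:R * T Y x y / T Y Y Y + 3%:R * T Y Y x * T Y Y y / T Y Y Y ^+ 2.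

Lemma metric_form_linear Y a x x' y :
  metric_form Y (a *: x + x') y = a * metric_form Y x y + metric_form Y x' y.
Proof.
by rewrite /metric_form !(cubic_polarDm, cubic_polarDr, cubic_polarZm, cubic_polarZr); ring.
Qed.

Lemma metric_form_sym Y x y : metric_form Y x y = metric_form Y y x.
Proof. by rewrite /metric_form (cubic_polarC23 _ Y x y); ring. Qed.

Lemma metric_form_sum Y x y :
  \sum_i \sum_j metric_form Y (delta_mx 0 i) (delta_mx 0 j) * x 0 i * y 0 j =
  metric_form Y x y.
Proof.
rewrite -[RHS](@linear_row_sum _ _ (fun x => metric_form Y x y)) => [|a v w]; last first.
  exact: metric_form_linear.
apply: eq_bigr => i _; rewrite [X in X * _]metric_form_sym.
rewrite -[X in X * _](@linear_row_sum _ _ (fun y => metric_form Y y (delta_mx 0 i)))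
  => [|a v w]; last first.
  exact: metric_form_linear.
by rewrite mulr_suml; apply: eq_bigr => j _; rewrite metric_form_sym mulrAC.
Qed.

End MetricForm.

Section CanonicalMetricOfTube.
Variables (R : realType) (n : nat) (h : mpoly n R).
Hypothesis h3 : h \is ishomog1 3 mdeg.
Local Notation C := R[i].
Local Notation hC := (map_mpoly (real_complex R) h : mpoly n C).
Local Notation T := (cubic_polar hC).
Local Notation Imx := (map_mx (@complex.Im R)).
Local Notation Imc Z := (map_mx (real_complex R) (Imx Z) : 'rV[C]_n).
Local Notation conjv := (map_mx (@Num.conj C)).

Lemma metric_form_map Y x y :
  metric_form hC (map_mx (real_complex R) Y) (map_mx (real_complex R) x)
    (map_mx (real_complex R) y) = ((metric_form h Y x y)%:C)%C.
Proof.
rewrite /metric_form !cubic_polar_map.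
by rewrite !(rmorphD, rmorphM, rmorphN, fmorphV, rmorphXn, rmorph_nat).
Qed.

Lemma metric_coefE (Y : 'rV[R]_n) i j : cubic_polar h Y Y Y != 0 ->
  metric_coef h Y i j = metric_form h Y (delta_mx 0 i) (delta_mx 0 j).
Proof.
move=> h0; rewrite /metric_coef /metric_form peval_mderiv2 // !peval_mderiv1 // peval_cubic //.
rewrite (cubic_polarC23 _ _ _ Y) (cubic_polarC12 _ _ Y) (cubic_polarC23 _ Y (delta_mx 0 j)).
by field.
Qed.

Lemma hval_gc Z w : cubic_polar h (Imx Z) (Imx Z) (Imx Z) != 0 ->
  (forall i j, gc h Z i j = ((metric_coef h (Imx Z) i j)%:C)%C) ->
  hval (gc h Z) w = metric_form hC (Imc Z) w (conjv w).
Proof.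
move=> h0 gE; rewrite /hval -metric_form_sum.
apply: eq_bigr => i _; apply: eq_bigr => j _; rewrite gE metric_coefE //.
by rewrite -metric_form_map !map_delta_mx mxE.
Qed.

(** The values 8, [12 'i] and 12 of [gamma] combine with the normalization [- 4/3] to the
    coefficients of [metric_form]: [- (4/3) (12/8) = - 2] and [(4/3) (12/8)^2 = 3]. *)
Lemma gsE Z w : cubic_polar h (Imx Z) (Imx Z) (Imx Z) != 0 ->
  gs h Z w = metric_form hC (Imc Z) w (conjv w).
Proof.
move=> h0; rewrite /gs; have [_ ->] := is_diff_affine_lift h3 Z.
rewrite affine_liftE // /special_metric normCK rmorphM fmorphV /=.
rewrite !gamma_conj gamma_lift // gamma_lift_tan // gamma_tan //.
rewrite -gamma_conj gamma_lift_tan // !rmorphM !rmorph_nat /= conjCi cubic_polar_conj //.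
have -> : conjv (Imc Z) = Imc Z.
  by apply/rowP => j; rewrite !mxE conj_real_complex.
have h0C : T (Imc Z) (Imc Z) (Imc Z) != 0 by rewrite cubic_polar_map fmorph_eq0.
rewrite conjvK // /metric_form.
by field: (sqr_i R).
Qed.

End CanonicalMetricOfTube.

(** * The tube over a hypersurface *)

Section Polarization.
Variables (K : numFieldType) (n : nat).
Implicit Types x y z : 'rV[K]_n.

(** Inclusion-exclusion over the partial sums of [x], [y], [z]. Since 6 is invertible, the diagonal
    determines a symmetric trilinear form, which identifies [H] with [cubic_polar]. *)
Lemma polarization (F : 'rV[K]_n -> 'rV[K]_n -> 'rV[K]_n -> K) x y z :
  (forall x x' y z, F (x + x') y z = F x y z + F x' y z) ->
  (forall x y z, F x y z = F y x z) -> (forall x y z, F x y z = F x z y) ->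
  6%:R * F x y z = F (x + y + z) (x + y + z) (x + y + z)
    - F (x + y) (x + y) (x + y) - F (x + z) (x + z) (x + z)
    - F (y + z) (y + z) (y + z) + F x x x + F y y y + F z z z.
Proof.
move=> Dl C12 C23.
have Dm a b b' c : F a (b + b') c = F a b c + F a b' c.
  by rewrite !(C12 a) Dl.
have Dr a b c c' : F a b (c + c') = F a b c + F a b c'.
  by rewrite !(C23 a b) Dm.
rewrite !Dl !Dm !Dr.
(* Symmetry is unknown to [ring], so the arguments are sorted first. *)
rewrite (C12 y x x) (C12 y x y) (C12 y x z) (C12 z x x) (C12 z x y) (C12 z x z).
rewrite (C12 z y x) (C12 z y y) (C12 z y z).
rewrite (C23 x y x) (C23 x z x) (C23 x z y) (C23 y z x) (C23 y z y).
rewrite (C12 y x z) (C23 y y x) (C12 y x y) (C23 z z x) (C12 z x z) (C23 z z y) (C12 z y z).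
by rewrite ?(C23 y y x) ?(C12 y x y); ring.
Qed.

Lemma polar_form_unique (F G : 'rV[K]_n -> 'rV[K]_n -> 'rV[K]_n -> K) :
  (forall x x' y z, F (x + x') y z = F x y z + F x' y z) ->
  (forall x y z, F x y z = F y x z) -> (forall x y z, F x y z = F x z y) ->
  (forall x x' y z, G (x + x') y z = G x y z + G x' y z) ->
  (forall x y z, G x y z = G y x z) -> (forall x y z, G x y z = G x z y) ->
  (forall x, F x x x = G x x x) -> forall x y z, F x y z = G x y z.
Proof.
move=> F1 F2 F3 G1 G2 G3 FG x y z; apply: (@mulfI _ (6%:R : K)).
  by rewrite pnatr_eq0.
by rewrite (@polarization F) // (@polarization G) // !FG.
Qed.

End Polarization.

Section AffineCoordinates.
Variables (R : realType) (n : nat).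
Local Notation C := R[i].
Implicit Types z : 'rV[C]_(1 + n).
Local Notation z0 z := ((z : 'rV[C]_(1 + n)) 0 (lshift n (ord0 : 'I_1))).
Local Notation aff Z := (row_mx 1%:M Z : 'rV[C]_(1 + n)).

Definition affine_coord z : 'rV[C]_n := (z0 z)^-1 *: rsubmx z.

Lemma affine_coordK z : z0 z != 0 -> z = z0 z *: aff (affine_coord z).
Proof.
move=> z00; apply/rowP => j; case: (fintype.split_ordP j) => k ->; rewrite mxE.
  by rewrite row_mxEl mxE (ord1 k) eqxx mulr1.
by rewrite row_mxEr !mxE mulVKf.
Qed.

Lemma affine_coordZ a z : a != 0 -> affine_coord (a *: z) = affine_coord z.
Proof.
move=> a0; rewrite /affine_coord linearZ /= scalerA mxE invfM mulrAC mulVf //.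
by rewrite mul1r.
Qed.

Lemma affine_coord_aff Z : affine_coord (aff Z) = Z.
Proof. by rewrite /affine_coord z0_aff invr1 scale1r row_mxKr. Qed.

Lemma is_diff_affine_coord z : z0 z != 0 ->
  is_diff z affine_coord
    (fun v => (z0 z)^-1 *: (rsubmx v - z0 v / z0 z *: rsubmx z)).
Proof.
move=> z00; apply: is_diff_row => j.
have d0 := is_diff_inv (is_diff_coord z 0 (lshift n ord0)) z00.
apply: is_diff_ext (is_diff_mul d0 (is_diff_coord z 0 (rshift 1 j))) => y.
  by rewrite !mxE.
by rewrite !mxE; field.
Qed.

Lemma differentiable_affine_coord z : z0 z != 0 ->
  differentiable affine_coord z.
Proof. by move=> /is_diff_affine_coord []. Qed.

End AffineCoordinates.

Section TubeOverHypersurface.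
Variables (R : realType) (n : nat) (h : mpoly n R) (S : set 'rV[R]_n).
Hypothesis hS : cubic_hypersurface h S.
Local Notation C := R[i].
Local Notation Imx := (map_mx (@complex.Im R)).
Local Notation T := (cubic_polar h).
Implicit Types (Z : 'rV[C]_n) (z : 'rV[C]_(1 + n)).
Local Notation z0 z := ((z : 'rV[C]_(1 + n)) 0 (lshift n (ord0 : 'I_1))).
Local Notation aff Z := (row_mx 1%:M Z : 'rV[C]_(1 + n)).

Lemma hypersurface_homog : h \is ishomog1 3 mdeg.
Proof. by have [[]] := hS. Qed.
Local Notation h3 := hypersurface_homog.

Lemma hypersurface_eq1 Y : S Y -> T Y Y Y = 1.
Proof. by rewrite -peval_cubic ?h3 //; have [_ _ [Q _ ->] _ _] := hS => -[]. Qed.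

Lemma tube_pos Z : tube S Z -> 0 < peval h (Imx Z).
Proof.
move=> [t [Y [t0 SY ->]]]; rewrite peval_cubic ?h3 //.
rewrite cubic_polarZl cubic_polarZm cubic_polarZr hypersurface_eq1 // mulr1.
by rewrite !mulr_gt0.
Qed.

Lemma tube_polar_neq0 Z : tube S Z -> T (Imx Z) (Imx Z) (Imx Z) != 0.
Proof. by move=> /tube_pos; rewrite peval_cubic ?h3 // => /lt0r_neq0. Qed.

(** With [r] the cube root of [h] at [Im Z], the only point of the ray through [Im Z] on the level
    set is [Im Z] divided by [r]. As [S] is the level set cut by the open set [Q], membership in the
    tube means that [h] is positive at [Im Z] and that this point lies in [Q], both open
    conditions. *)
Lemma open_tube : open (tube S).
Proof.
have [_ _ [Q oQ SE] _ _] := hS.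
pose r (Y : 'rV[R]_n) := expR (ln (peval h Y) / 3%:R).
have r3 Y : 0 < peval h Y -> r Y ^+ 3 = peval h Y.
  move=> hY; rewrite /r -expRM_natl mulrC divfK ?pnatr_eq0 //.
  by rewrite lnK // posrE.
have tubeE Z : tube S Z <-> 0 < peval h (Imx Z) /\ Q ((r (Imx Z))^-1 *: Imx Z).
  split=> [tZ|[hZ QZ]]; last first.
    exists (r (Imx Z)), ((r (Imx Z))^-1 *: Imx Z); split; first exact: expR_gt0.
      rewrite SE; split=> //.
      change (peval h ((r (Imx Z))^-1 *: Imx Z) = 1); rewrite peval_cubic ?h3 //.
      rewrite cubic_polarZl cubic_polarZm cubic_polarZr -peval_cubic ?h3 // -r3 //.
      by field; rewrite gt_eqF // expR_gt0.
    by rewrite scalerA divff ?scale1r // gt_eqF // expR_gt0.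
  have hZ := tube_pos tZ; split=> //.
  have [t [Y [t0 SY YE]]] := tZ.
  suff -> : r (Imx Z) = t.
    rewrite YE scalerA mulVf ?gt_eqF // scale1r.
    by move: SY; rewrite SE => -[].
  (* Both numbers are nonnegative and have the same cube. *)
  apply: (@pexpIrn _ 3) => //; rewrite ?nnegrE ?expR_ge0 ?(ltW t0) //.
  rewrite r3 // YE peval_cubic ?h3 // cubic_polarZl cubic_polarZm cubic_polarZr.
  by rewrite hypersurface_eq1 // mulr1 !exprS expr0 mulr1.
rewrite openE => Z /tubeE [hZ QZ].
have ch : (fun Z => peval h (Imx Z)) @ Z --> peval h (Imx Z).
  apply: (@continuous_comp _ _ _ Imx (peval h)); first exact: map_Im_continuous.
  by apply: differentiable_continuous; case: (is_diff_peval h (Imx Z)).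
have FZ : Filter (nbhs Z) by exact: nbhs_filter.
have c1 := cvg_comp _ _ ch (continuous_ln hZ).
have c2 := cvgM c1 (cvg_cst (3%:R^-1 : R)).
have c3 := cvg_comp _ _ (c2 FZ FZ) (@continuous_expR R _).
have rZ0 : r (Imx Z) != 0 by rewrite gt_eqF // expR_gt0.
have cr : (fun Z => (r (Imx Z))^-1 *: Imx Z) @ Z --> (r (Imx Z))^-1 *: Imx Z.
  apply: (cvgZ (F := nbhs Z) (FF := FZ)); last exact: map_Im_continuous.
  by apply: (cvgV (F := nbhs Z) (FF := FZ)); [exact: rZ0 | exact: c3].
have n1 : \forall Z' \near Z, 0 < peval h (Imx Z') by exact: (cvgr_gt _ ch).
have n2 : \forall Z' \near Z, Q ((r (Imx Z'))^-1 *: Imx Z').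
  by apply: cr; exact: open_nbhs_nbhs.
by near=> Z'; apply/tubeE; split; near: Z'.
Unshelve. all: by end_near. Qed.

Lemma cone_domainE z : cone_domain S z <-> z0 z != 0 /\ tube S (affine_coord z).
Proof.
split=> [[a [Z [a0 tZ ->]]]|[z00 tz]]; last first.
  by exists (z0 z), (affine_coord z); split=> //; exact: affine_coordK.
by rewrite affine_coordZ // affine_coord_aff mxE z0_aff mulr1.
Qed.

Lemma open_cone_domain : open (cone_domain S).
Proof.
rewrite openE => z /cone_domainE [z00 tz].
have n2 : \forall y \near z, tube S (affine_coord y).
  apply: (differentiable_continuous (differentiable_affine_coord z00)).
  by apply: open_nbhs_nbhs; split=> //; exact: open_tube.
have n1 := near_z0_neq0 z00.
by near=> y; apply/cone_domainE; split; near: y.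
Unshelve. all: by end_near. Qed.

Lemma tube_imaginary (Y : 'rV[R]_n) : S Y -> tube S ('i *: map_mx (real_complex R) Y).
Proof.
move=> SY; exists 1, Y; split=> //; rewrite scale1r; apply/rowP => j; rewrite !mxE /=.
by rewrite mul0r mul1r add0r.
Qed.

Lemma segment_component (A : set 'rV[C]_(1 + n)) (v w : 'rV[C]_(1 + n)) :
  (forall t : R, 0 <= t <= 1 -> A (v + (t%:C)%C *: (w - v))) ->
  connected_component A v w.
Proof.
move=> Avw; have := @curve_component _ R A (fun t => v + (t%:C)%C *: (w - v)).
rewrite scale0r addr0 scale1r (addrC v (w - v)) subrK; apply => //.
exact: real_line_continuous.
Qed.

(* The punctured plane is connected: a segment in it joins [a] to 1 if [a] is
   not real, and to 'i otherwise. *)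
Lemma punctured_segment (a b : C) (t : R) : a != 0 ->
  (complex.Im a != 0 /\ b = 1) \/ (complex.Im a = 0 /\ b = 'i) ->
  a + (t%:C)%C * (b - a) != 0.
Proof.
move=> a0 [[ia ->]|[ia ->]].
  apply/negP => /eqP E; have := congr1 (@complex.Im R) E.
  case: a a0 ia E => a1 a2 a0 /= ia E; rewrite !add0r mul0r addr0 mulrN.
  move=> /eqP; rewrite subr_eq0 -{1}[a2]mul1r => /eqP/(mulIf ia) t1.
  by move: E; rewrite -t1 => /eqP; rewrite mul1r addrC subrK oner_eq0.
apply/negP => /eqP E; have := congr1 (@complex.Im R) E.
case: a a0 ia E => a1 a2 a0 /= ia E; rewrite ia in a0 E *.
rewrite !add0r mul0r addr0 subr0 mulr1 => t0.
by move: E; rewrite t0 => /eqP; rewrite mul0r addr0 (negPf a0).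
Qed.

(** A point is joined in three moves: the factor [a] goes to 1 in the punctured plane; then [Z] goes
    straight to ['i Y] with [Y] in [S], its imaginary part staying on the ray through [Y]; finally
    [Y] moves within the connected set [S]. *)
Lemma connected_cone_domain : connected (cone_domain S).
Proof.
have step Z (a b : C) : tube S Z -> a != 0 -> b != 0 ->
    (complex.Im a != 0 /\ b = 1) \/ (complex.Im a = 0 /\ b = 'i) ->
    connected_component (cone_domain S) (a *: aff Z) (b *: aff Z).
  move=> tZ a0 b0 ab; apply: segment_component => t t01.
  rewrite -scalerBl scalerA -scalerDl.
  by exists (a + (t%:C)%C * (b - a)), Z; split=> //; exact: punctured_segment.
have i0 : 'i != 0 :> C by exact: neq0Ci.
have toone Z (a : C) : tube S Z -> a != 0 ->
    connected_component (cone_domain S) (a *: aff Z) (aff Z).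
  move=> tZ a0; rewrite -[X in connected_component _ _ X]scale1r.
  (* A real [a] goes to ['i] and from there to 1; otherwise one segment is enough. *)
  have [ia|ia] := eqVneq (complex.Im a) 0.
    apply: (@connected_component_trans _ _ ('i *: aff Z)).
      by apply: step => //; right.
    by apply: step; rewrite ?oner_neq0 //; left; split=> //=; exact: oner_neq0.
  by apply: step; rewrite ?oner_neq0 //; left.
have toim Z : tube S Z -> exists2 Y, S Y &
    connected_component (cone_domain S) (aff Z) (aff ('i *: map_mx (real_complex R) Y)).
  move=> [t [Y [t0 SY ZE]]]; exists Y => //; apply: segment_component => s /andP[s0 s1].
  exists 1, (Z + (s%:C)%C *: ('i *: map_mx (real_complex R) Y - Z)); split.
  - exact: oner_neq0.
  - exists ((1 - s) * t + s), Y; split=> //.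
      have [->|s10] := eqVneq s 1; first by rewrite subrr mul0r add0r.
      by apply: ltr_wpDr => //; rewrite mulr_gt0 // subr_gt0 lt_neqAle s10.
    rewrite map_Im_line map_mxB ZE.
    have -> : Imx ('i *: map_mx (real_complex R) Y) = Y.
      by apply/rowP => j; rewrite !mxE /= mul0r mul1r add0r.
    by apply/rowP => j; rewrite !mxE; ring.
  - rewrite scale1r opp_row_mx add_row_mx scale_row_mx add_row_mx; congr (row_mx _ _).
    by rewrite subrr scaler0 addr0.
(* No path is chosen inside [S]: its continuous image is a connected subset of the cone domain
   containing both points. *)
have SS Y Y' : S Y -> S Y' -> connected_component (cone_domain S)
    (aff ('i *: map_mx (real_complex R) Y)) (aff ('i *: map_mx (real_complex R) Y')).
  move=> SY SY'; have [_ _ _ cS _] := hS.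
  pose f (Y : 'rV[R]_n) := aff ('i *: map_mx (real_complex R) Y).
  apply: (@connected_subset_component _ _ (f @` S)).
  - apply: connected_continuous_connected => //; apply: continuous_subspaceT => X.
    apply: continuous_row => j; case: (fintype.split_ordP j) => k ->.
      have -> : (fun y => f y 0 (lshift n k)) = cst ((1%:M : 'M[C]_1) 0 k).
        by apply/funext => y; rewrite /f row_mxEl.
      exact: cst_continuous.
    have -> : (fun y => f y 0 (rshift 1 k)) = (fun x : R => 'i * (x%:C)%C : C) \o
        (fun y : 'rV[R]_n => y 0 k).
      by apply/funext => y; rewrite /f row_mxEr !mxE.
    apply: continuous_comp; first exact: coord_continuous.
    apply: cvgM; first exact: cvg_cst.
    exact: real_complex_continuous.
  - move=> _ [X SX <-]; exists 1, ('i *: map_mx (real_complex R) X); split.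
    + exact: oner_neq0.
    + exact: tube_imaginary.
    + by rewrite scale1r.
  - by exists Y.
  - by exists Y'.
have all z : cone_domain S z -> exists2 Y, S Y &
    connected_component (cone_domain S) z (aff ('i *: map_mx (real_complex R) Y)).
  move=> [a [Z [a0 tZ ->]]]; have [Y SY cY] := toim Z tZ; exists Y => //.
  by apply: connected_component_trans cY; exact: toone.
apply: connected_componentP => x y /all [Y SY xY] /all [Y' SY' yY'].
apply: connected_component_trans xY _.
apply: connected_component_trans (SS _ _ SY SY') _.
exact: connected_component_sym.
Qed.

End TubeOverHypersurface.

(** * Nondegeneracy and signature *)

Section MatrixForms.
Variable K : fieldType.

Lemma scale_diag_congruence m n (A : 'M[K]_(m, n)) G t :
  (t *: A) *m G *m (t *: A)^T = t ^+ 2 *: (A *m G *m A^T).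
Proof. by rewrite linearZ /= -scalemxAl -scalemxAl -scalemxAr scalerA. Qed.

Definition signs m (k : nat) : 'rV[K]_m := \row_i (if (i < k)%N then 1 else -1).

(** A row combination killed by [A] is killed by an invertible diagonal matrix. Together with full
    rank this makes [k.+1 + l = n] a consequence in [hermitian_signature_rect]. *)
Lemma row_free_congruence m n k (A : 'M[K]_(m, n)) (B : 'M[K]_(n, m)) G :
  A *m G *m B = diag_mx (signs m k) -> row_free A.
Proof.
move=> AGB; apply: inj_row_free => v vA.
have : v *m diag_mx (signs m k) = 0 by rewrite -AGB !mulmxA vA !mul0mx.
move=> /rowP vD; apply/rowP => j; have := vD j.
rewrite mul_mx_diag !mxE; case: ifP => _; first by rewrite mulr1.
by rewrite mulrN1 => /eqP; rewrite oppr_eq0 => /eqP.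
Qed.

End MatrixForms.

(** * Hermitian squares, congruence and signature *)

Section HermitianMatrices.
Variables (R : realType).
Local Notation C := R[i].
Local Notation conjm := (map_mx (@Num.conj C)).

Definition hform m (G : 'M[C]_m) (x y : 'rV[C]_m) : C :=
  \sum_i \sum_j G i j * x 0 i * (y 0 j)^*.

Lemma hformE m (G : 'M[C]_m) x y : hform G x y = (x *m G *m (conjm y)^T) 0 0.
Proof.
rewrite /hform exchange_big mxE; apply: eq_bigr => j _.
by rewrite !mxE mulr_suml; apply: eq_bigr => i _; ring.
Qed.

Lemma hform_linear m (G : 'M[C]_m) a x x' y :
  hform G (a *: x + x') y = a * hform G x y + hform G x' y.
Proof. by rewrite !hformE !mulmxDl -!scalemxAl mxE [X in X + _]mxE. Qed.

Lemma hform_linearr m (G : 'M[C]_m) a x y y' :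
  hform G x (a *: y + y') = a^* * hform G x y + hform G x y'.
Proof.
rewrite !hformE; have -> : conjm (a *: y + y') = a^* *: conjm y + conjm y'.
  by apply/rowP => j; rewrite !mxE rmorphD rmorphM.
by rewrite linearP /= mulmxDr -scalemxAr mxE [X in X + _]mxE.
Qed.

(** Complex polarization: the vectors [x + y] and ['i x + y] force both the sum and the difference
    of [hform G x y] and [hform G y x] to vanish. *)
Lemma hval_eq0 m (G : 'M[C]_m) : (forall w, hval G w = 0) -> G = 0.
Proof.
move=> G0; have F0 w : hform G w w = 0 by exact: G0.
have xy x y : hform G x y = 0.
  have H1 := F0 (1 *: x + y); rewrite hform_linear !hform_linearr !F0 conjC1 in H1.
  have H2 := F0 ('i *: x + y); rewrite hform_linear !hform_linearr !F0 conjCi in H2.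
  have e1 : hform G y x = - hform G x y.
    by apply/eqP; rewrite -addr_eq0 -[X in _ == X]H1; apply/eqP; ring.
  have e2 : 2%:R * 'i * hform G x y = 0 by rewrite -[RHS]H2 e1; ring.
  by move/eqP: e2; rewrite !mulf_eq0 pnatr_eq0 (negPf (neq0Ci _)) => /eqP.
apply/matrixP => i j; rewrite mxE -[RHS](xy (delta_mx 0 i) (delta_mx 0 j)) hformE.
rewrite -rowE map_delta_mx trmx_delta -colE !mxE.
by [].
Qed.

Lemma hval_inj m (G G' : 'M[C]_m) : (forall w, hval G w = hval G' w) -> G = G'.
Proof.
move=> E; apply/subr0_eq/hval_eq0 => w.
rewrite -(subrr (hval G' w)) -{1}E /hval -sumrB; apply: eq_bigr => i _.
by rewrite -sumrB; apply: eq_bigr => j _; rewrite !mxE; ring.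
Qed.

Lemma hval_congruence m (G P : 'M[C]_m) w :
  hval (P *m G *m (conjm P)^T) w = hval G (w *m P).
Proof.
rewrite -[LHS]/(hform _ w w) -[RHS]/(hform _ (w *m P) (w *m P)) !hformE.
by rewrite map_mxM trmx_mul !mulmxA.
Qed.

Lemma unitmx_conj_tr m (P : 'M[C]_m) : P \in unitmx -> (conjm P)^T \in unitmx.
Proof. by move=> Pu; rewrite unitmx_tr map_unitmx. Qed.

Lemma hermitian_signature_congruence m (G P : 'M[C]_m) p q :
  P \in unitmx -> hermitian_signature G p q ->
  hermitian_signature (P *m G *m (conjm P)^T) p q.
Proof.
move=> Pu [pq [Q Qu QE]]; split=> //; exists (Q *m invmx P).
  by rewrite unitmx_mul Qu unitmx_inv.
rewrite -QE map_mxM trmx_mul !mulmxA mulmxKV // map_invmx trmx_inv mulmxK //.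
exact: unitmx_conj_tr.
Qed.

Lemma hermitian_signature_rect n k l (G : 'M[C]_n) (P : 'M[C]_(k.+1 + l, n)) :
  row_full P -> P *m G *m (conjm P)^T = diag_mx (signs C (k.+1 + l) k.+1) ->
  hermitian_signature G k.+1 l.
Proof.
move=> Pfull PE; have Pfree := row_free_congruence PE.
have e : (k.+1 + l)%N = n by rewrite -(eqP Pfree) (eqP Pfull).
(* Replacing [n] by [k.+1 + l] in the types makes [P] a square matrix. *)
move: G P Pfull PE Pfree; rewrite -e => G P Pfull PE Pfree; split=> //.
by exists P => //; rewrite -row_free_unit.
Qed.

End HermitianMatrices.

Section RealMetric.
Variables (R : realType) (n : nat) (h : mpoly n R).
Variables (H : 'rV[R]_n -> 'rV[R]_n -> 'rV[R]_n -> R) (S : set 'rV[R]_n).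
Hypothesis hS : cubic_hypersurface h S.
Hypothesis hH : polar_form h H.
Local Notation C := R[i].
Local Notation Imx := (map_mx (@complex.Im R)).
Local Notation Rex := (map_mx (@complex.Re R)).
Local Notation toC := (map_mx (real_complex R)).
Local Notation hC := (map_mpoly (real_complex R) h : mpoly n C).
Local Notation T := (cubic_polar h).
Local Notation conjv := (map_mx (@Num.conj C)).
Implicit Types (X Y x y : 'rV[R]_n) (Z w : 'rV[C]_n).
Local Notation h3 := (hypersurface_homog hS).

Lemma metric_form0 Y y : metric_form h Y 0 y = 0.
Proof.
apply: (@addrI _ (1 * metric_form h Y 0 y)).
by rewrite -metric_form_linear scale1r addr0 mul1r addr0.
Qed.

Lemma polar_formE X Y x : H X Y x = T X Y x.
Proof.
have [H1 H2 H3 H4] := hH; apply: polar_form_unique => //.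
- by move=> a b c d; have := H1 1 a b c d; rewrite scale1r mul1r.
- exact: cubic_polarDl.
- exact: cubic_polarC12.
- exact: cubic_polarC23.
- by move=> a; rewrite -H4; exact: (peval_cubic h3).
Qed.

Lemma metric_formZ t Y x y :
  t != 0 -> metric_form h (t *: Y) x y = t ^- 2 * metric_form h Y x y.
Proof.
move=> t0; rewrite /metric_form !cubic_polarZl !cubic_polarZm cubic_polarZr.
(* If [T Y Y Y] vanishes, both sides are zero because the inverse of zero is zero. *)
have [h0|h0] := eqVneq (T Y Y Y) 0.
  by rewrite h0 !mulr0 expr0n /= invr0 !mulr0 addr0 mulr0.
by field; rewrite h0 t0.
Qed.

Lemma metric_form_tangent X Y : T X X X = 1 -> T X X Y = 0 ->
  forall y, metric_form h X Y y = canonical_metric H X Y y.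
Proof.
move=> X1 XY y; rewrite /metric_form /canonical_metric polar_formE X1 XY.
by rewrite expr1n !divr1 mulr0 mul0r addr0.
Qed.

(** The coefficients [-2] and [3] add up to 1. Hence [X] has square 1, and the vectors orthogonal to
    it are exactly the tangent ones. *)
Lemma metric_form_position X y : T X X X = 1 -> metric_form h X X y = T X X y.
Proof. by move=> X1; rewrite /metric_form X1 expr1n !divr1; ring. Qed.

Lemma tangent_decomposition X y : T X X X = 1 ->
  T X X (y - T X X y *: X) = 0.
Proof. by move=> X1; rewrite -scaleNr cubic_polarDr cubic_polarZr X1 mulr1 subrr. Qed.

(** A vector in the kernel is orthogonal to the position vector [Y], hence tangent, and on tangent
    vectors the form is the canonical metric. Scaling by [t] reduces to points of [S]. *)
Lemma metric_form_nondegenerate : pseudo_riemannian H S -> forall Z, tube S Z ->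
  forall x, (forall y, metric_form h (Imx Z) x y = 0) -> x = 0.
Proof.
move=> nd Z [t [Y [t0 SY ->]]] x xE; have Y1 := hypersurface_eq1 hS SY.
have {}xE y : metric_form h Y x y = 0.
  apply: (@mulfI _ (t ^- 2)); first by rewrite invr_eq0 expf_neq0 // gt_eqF.
  by rewrite -metric_formZ ?gt_eqF // xE mulr0.
have xT : T Y Y x = 0 by rewrite -metric_form_position // metric_form_sym xE.
apply: (nd Y) => //; first by rewrite /tangent_hyp polar_formE.
by move=> y _; rewrite -metric_form_tangent.
Qed.

(** In the orthogonal decomposition of [x] into [a *: Y] and a tangent vector [x'], the value is
    [a ^+ 2] plus the canonical metric at [x'], and the two parts do not both vanish. *)
Lemma metric_form_posdef : riemannian H S -> forall Z, tube S Z ->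
  forall x, x != 0 -> 0 < metric_form h (Imx Z) x x.
Proof.
move=> pd Z [t [Y [t0 SY ->]]] x x0; have Y1 := hypersurface_eq1 hS SY.
rewrite metric_formZ ?gt_eqF // pmulr_rgt0 ?invr_gt0 ?exprn_gt0 //.
set a := T Y Y x; set x' := x - a *: Y.
have x'T : T Y Y x' = 0 by exact: tangent_decomposition.
have -> : x = a *: Y + x' by rewrite addrC subrK.
rewrite metric_form_linear metric_form_position // metric_form_tangent //.
rewrite -metric_form_tangent // [metric_form _ _ x' _]metric_form_sym.
rewrite metric_form_linear metric_form_position // x'T mulr0 add0r.
rewrite cubic_polarDr cubic_polarZr Y1 x'T addr0 mulr1 metric_form_tangent //.
have [x'0|x'0] := eqVneq x' 0.
  have a0 : a != 0.
    by apply: contraNneq x0 => a0; rewrite -(subrK (a *: Y) x) -/x' x'0 a0 scale0r addr0.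
  have -> : canonical_metric H Y x' x' = 0.
    by rewrite /canonical_metric polar_formE x'0 -(scale0r 0) cubic_polarZr mul0r mulr0.
  by rewrite addr0 -expr2 exprn_even_gt0.
apply: ltr_wpDl; first by rewrite -expr2 sqr_ge0.
by apply: (pd Y) => //; rewrite /tangent_hyp polar_formE.
Qed.

Definition real_metric Y : 'M[R]_n := \matrix_(i, j) metric_coef h Y i j.

Lemma real_metricE m p (A : 'M[R]_(m, n)) (B : 'M[R]_(p, n)) Y i j :
  T Y Y Y != 0 ->
  (A *m real_metric Y *m B^T) i j = metric_form h Y (row i A) (row j B).
Proof.
move=> Y0; rewrite -metric_form_sum exchange_big mxE; apply: eq_bigr => k _.
rewrite !mxE mulr_suml; apply: eq_bigr => l _.
by rewrite !mxE metric_coefE //; last exact: h3; ring.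
Qed.

Lemma gc_real_metric Z : tube S Z -> gc h Z = toC (real_metric (Imx Z)).
Proof.
move=> tZ; apply/matrixP => i j.
by rewrite (gcE (open_tube hS) (@tube_pos _ _ _ _ hS)) // !mxE.
Qed.

Lemma hval_gc_tube Z w : tube S Z ->
  hval (gc h Z) w = metric_form hC (toC (Imx Z)) w (conjv w).
Proof.
move=> tZ; apply: hval_gc; [exact: h3 | exact: (tube_polar_neq0 hS) |].
by move=> i j; rewrite (gcE (open_tube hS) (@tube_pos _ _ _ _ hS)).
Qed.

Lemma gs_gc Z w : tube S Z -> hval (gc h Z) w = gs h Z w.
Proof.
by move=> tZ; rewrite hval_gc_tube // gsE //; [exact: h3 | exact: (tube_polar_neq0 hS)].
Qed.

Lemma gc_hermitian Z : tube S Z -> hermitian_mx (gc h Z).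
Proof.
move=> tZ; rewrite gc_real_metric //; apply/matrixP => i j.
rewrite !mxE conj_real_complex; congr ((_)%:C)%C.
by rewrite !(metric_coefE h3) ?(tube_polar_neq0 hS tZ) // metric_form_sym.
Qed.

Lemma gc_unit : pseudo_riemannian H S -> forall Z, tube S Z -> gc h Z \in unitmx.
Proof.
move=> nd Z tZ; rewrite gc_real_metric // map_unitmx -row_free_unit.
apply: inj_row_free => v vG; apply: (metric_form_nondegenerate nd tZ) => y.
have -> : metric_form h (Imx Z) v y = (v *m real_metric (Imx Z) *m y^T) 0 0.
  by rewrite real_metricE ?(tube_polar_neq0 hS tZ) // !row_id.
by rewrite vG mul0mx mxE.
Qed.

Lemma metric_form_Re_Im Y w y : metric_form hC (toC Y) w (toC y) =
  ((metric_form h Y (Rex w) y)%:C)%C + 'i * ((metric_form h Y (Imx w) y)%:C)%C.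
Proof.
rewrite {1}(row_ReIm w) addrC metric_form_linear !metric_form_map.
by rewrite addrC.
Qed.

(** The form has real coefficients, so testing on real vectors separates the real and imaginary
    parts of [w]. *)
Lemma complex_metric_form_nondegenerate : pseudo_riemannian H S ->
  forall Z, tube S Z ->
  forall w, (forall y : 'rV[C]_n, metric_form hC (toC (Imx Z)) w y = 0) -> w = 0.
Proof.
move=> nd Z tZ w wE; rewrite (row_ReIm w).
have E y : metric_form h (Imx Z) (Rex w) y = 0 /\ metric_form h (Imx Z) (Imx w) y = 0.
  have := wE (toC y); rewrite metric_form_Re_Im => /eqP.
  by rewrite eq_complex /= !mul0r !mulr0 mul1r subr0 addr0 !add0r => /andP[/eqP-> /eqP->].
rewrite (metric_form_nondegenerate nd tZ (fun y => (E y).1)).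
rewrite (metric_form_nondegenerate nd tZ (fun y => (E y).2)).
by rewrite map_mx0 scaler0 addr0.
Qed.

Lemma gc_posdef : riemannian H S -> forall Z, tube S Z -> posdef_mx (gc h Z).
Proof.
move=> pd Z tZ w w0; rewrite hval_gc_tube //.
(* The mixed terms cancel by the symmetry of the real form. *)
have -> : metric_form hC (toC (Imx Z)) w (conjv w) =
  ((metric_form h (Imx Z) (Rex w) (Rex w) + metric_form h (Imx Z) (Imx w) (Imx w))%:C)%C.
  rewrite row_conj_ReIm -scaleNr addrC metric_form_sym metric_form_linear.
  rewrite ![metric_form _ _ (toC _) w]metric_form_sym !metric_form_Re_Im [in RHS]rmorphD /=.
  rewrite (metric_form_sym h _ (Imx w) (Rex w)).
  by ring: (@sqr_i R).
rewrite ltcR; have [R0|R0] := eqVneq (Rex w) 0; last first.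
  apply: ltr_pwDl; first exact: metric_form_posdef.
  have [->|I0] := eqVneq (Imx w) 0; last by rewrite ltW // metric_form_posdef.
  by rewrite metric_form0.
have I0 : Imx w != 0.
  by apply: contraNneq w0 => I0; rewrite (row_ReIm w) R0 I0 !map_mx0 scaler0 addr0.
apply: ltr_wpDl; last exact: metric_form_posdef.
by rewrite R0 metric_form0.
Qed.

Lemma gc_signature k l : has_signature H S k l -> forall Z, tube S Z ->
  hermitian_signature (gc h Z) k.+1 l.
Proof.
move=> sg Z tZ; have [t [Y [t0 SY ZE]]] := tZ; have Y1 := hypersurface_eq1 hS SY.
have [E [EY EG]] := sg Y SY.
have EYi i : T Y Y (row i E) = 0.
  by rewrite -polar_formE; apply/EY; exact: row_sub.
(* The position vector comes first: it supplies the additional positive direction. *)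
pose P : 'M[R]_(1 + (k + l), n) := col_mx Y E.
have Y0 : T Y Y Y != 0 by rewrite Y1 oner_neq0.
have PE : P *m real_metric Y *m P^T = diag_mx (signs R (1 + (k + l)) k.+1).
  apply/matrixP => i j; rewrite real_metricE // !mxE.
  rewrite /P; case: (fintype.split_ordP i) => i' -> {i}; case: (fintype.split_ordP j) => j' -> {j}.
  - by rewrite !rowKu !row_id metric_form_position // Y1 (ord1 i') (ord1 j') eqxx.
  - by rewrite rowKu rowKd row_id metric_form_position // EYi (ord1 i').
  - by rewrite rowKu rowKd row_id metric_form_sym metric_form_position // EYi (ord1 j').
  - rewrite !rowKd metric_form_tangent // EG -[rshift _ i' == _]/(_ == _).
    (* Row [i'] of [E] has index [i'.+1] in [P], and [i'.+1 < k.+1] means [i' < k]. *)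
    by rewrite /= (inj_eq (@rshift_inj _ _)); case: eqP => // ->; rewrite /= ltnS.
have Pfull : row_full P.
  rewrite -sub1mx; apply/row_subP => i; set x := row i _.
  have -> : x = T Y Y x *: Y + (x - T Y Y x *: Y) by rewrite addrC subrK.
  apply: addmx_sub.
    by apply: scalemx_sub; rewrite -addsmxE addsmxSl.
  rewrite /P -addsmxE; apply: submx_trans (addsmxSr _ _).
  by apply/EY; rewrite /tangent_hyp polar_formE tangent_decomposition.
have Cfull : row_full (toC (t *: P)).
  have tn0 : t != 0 by rewrite gt_eqF.
  rewrite row_full_map /row_full (eqmx_scale P tn0); exact: Pfull.
(* Scaling the point by [t] divides the metric by [t ^+ 2]; the frame [t *: P] compensates for
   this. *)
have GE : real_metric (t *: Y) = t ^- 2 *: real_metric Y.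
  have tY0 : T (t *: Y) (t *: Y) (t *: Y) != 0.
    by rewrite cubic_polarZl cubic_polarZm cubic_polarZr Y1 !mulf_neq0 ?oner_neq0 ?gt_eqF.
  apply/matrixP => i j; rewrite !mxE !(metric_coefE h3) //.
  by rewrite metric_formZ // gt_eqF.
have CE : toC (t *: P) *m gc h Z *m (map_mx (@Num.conj C) (toC (t *: P)))^T =
    diag_mx (signs C (1 + (k + l)) k.+1).
  have -> : map_mx (@Num.conj C) (toC (t *: P)) = toC (t *: P).
    by apply/matrixP => i j; rewrite !mxE conj_real_complex.
  rewrite gc_real_metric // ZE map_trmx -!map_mxM.
  rewrite scale_diag_congruence GE -scalemxAr -scalemxAl scalerA.
  rewrite divff ?expf_neq0 ?gt_eqF // scale1r PE.
  apply/matrixP => i j; rewrite !mxE.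
  by case: (_ == _); case: (_ < _)%N; rewrite ?mulr1n ?mulr0n ?rmorph0 ?rmorph1 ?rmorphN1.
exact: (@hermitian_signature_rect _ _ k l _ (toC (t *: P)) Cfull CE).
Qed.

End RealMetric.

(** * The Lagrangean cone *)

Section LagrangeanConeOfPrepotential.
Variables (R : realType) (n : nat) (h : mpoly n R).
Variables (H : 'rV[R]_n -> 'rV[R]_n -> 'rV[R]_n -> R) (S : set 'rV[R]_n).
Hypothesis hS : cubic_hypersurface h S.
Hypothesis hH : polar_form h H.
Local Notation C := R[i].
Local Notation V := ('rV[C]_(1 + n) * 'rV[C]_(1 + n))%type.
Local Notation Imx := (map_mx (@complex.Im R)).
Local Notation toC := (map_mx (real_complex R)).
Local Notation hC := (map_mpoly (real_complex R) h : mpoly n C).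
Local Notation T := (cubic_polar hC).
Local Notation conjv := (map_mx (@Num.conj C)).
Local Notation z0 z := ((z : 'rV[C]_(1 + n)) 0 (lshift n (ord0 : 'I_1))).
Local Notation aff Z := (row_mx 1%:M Z : 'rV[C]_(1 + n)).
Local Notation tan w := (row_mx 0 w : 'rV[C]_(1 + n)).
Local Notation h3 := (hypersurface_homog hS).
Local Notation L := (lagrangean_cone_of h S).
Implicit Types (Z : 'rV[C]_n) (u v : V).

Lemma cone_domain_z0 z : cone_domain S z -> z0 z != 0.
Proof. by move=> /cone_domainE []. Qed.

Lemma cone_dgraph z : cone_domain S z -> L (z, pot_row h z).
Proof. by move=> zS; exists z; rewrite // dgraphE //; [exact: h3 | exact: cone_domain_z0]. Qed.

Lemma coneP u : L u -> cone_domain S u.1 /\ u = (u.1, pot_row h u.1).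
Proof.
move=> [z zS <-]; rewrite dgraphE //; [exact: h3 | exact: cone_domain_z0].
Qed.

Lemma scaled_lift (a : C) Z : a != 0 ->
  a *: affine_lift h Z = (a *: aff Z, pot_row h (a *: aff Z)).
Proof.
move=> a0; rewrite affine_liftE ?h3 // pot_rowZ //.
by rewrite z0_aff oner_neq0.
Qed.

Lemma cone_lift u : L u -> [/\ z0 u.1 != 0, tube S (affine_coord u.1) &
  u = z0 u.1 *: affine_lift h (affine_coord u.1)].
Proof.
move=> /coneP [/cone_domainE [u0 tu] uE]; split=> //.
by rewrite scaled_lift // -affine_coordK // -uE.
Qed.

Lemma lift_in_cone (a : C) Z : a != 0 -> tube S Z -> L (a *: affine_lift h Z).
Proof.
move=> a0 tZ; rewrite scaled_lift //; apply: cone_dgraph.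
by exists a, Z.
Qed.

Lemma hess_row_linear z a (v w : 'rV[C]_(1 + n)) :
  hess_row h z (a *: v + w) = a *: hess_row h z v + hess_row h z w.
Proof.
apply/rowP => j; rewrite !mxE hess_sym hess_linear.
by rewrite ![hess h z (delta_mx 0 j) _]hess_sym.
Qed.

Lemma hess_row_scale z a (v : 'rV[C]_(1 + n)) :
  hess_row h z (a *: v) = a *: hess_row h z v.
Proof.
have /eqP := hess_row_linear z 1 0 0; rewrite scale1r addr0 scale1r.
rewrite -subr_eq0 opprD addrA subrr sub0r oppr_eq0 => /eqP hz0.
by rewrite -[a *: v]addr0 hess_row_linear hz0 addr0.
Qed.

(* Euler's relation: [dF] is homogeneous of degree 1. *)
Lemma hess_row_id z : z0 z != 0 -> hess_row h z z = pot_row h z.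
Proof. by move=> z00; apply/rowP => j; rewrite !mxE /hess /dprep; field. Qed.

(** Near 0 a curve in the cone is the image under [dgraph] of its own base component, so its
    velocity can be computed in two ways. Conversely, [dgraph] lifts a straight line in the base to
    a curve with the prescribed velocity. *)
Lemma tangent_coneP u v : L u ->
  tangent L u v <-> v = (v.1, hess_row h u.1 v.1).
Proof.
move=> Lu; have [uS uE] := coneP Lu; have u0 := cone_domain_z0 uS.
split=> [[c [c0 Lc cv]]|->].
  have dc : is_diff (0 : C) c (fun t : C => t *: v).
    have cd : differentiable c (0 : C) by apply/derivable1_diffP; case: cv.
    apply: DiffDef => //; apply/funext => t.
    rewrite -[t in LHS]mulr1 [LHS]linearZ; congr (_ *: _).
    by rewrite -deriveE //; case: cv.
  have d1 : is_diff (0 : C) (fst \o c) (fun t : C => t *: v.1).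
    apply: (@is_diff_ext _ _ _ (fst \o c) _ (fst \o (fun t : C => t *: v))) => //.
    exact: is_diff_comp dc (is_diff_fst _).
  have c01 : z0 ((fst \o c) 0) != 0 by rewrite /= c0.
  have d2 := is_diff_comp d1 (is_diff_dgraph h3 c01).
  have d3 : is_diff (0 : C) c ((fun w => (w, hess_row h ((fst \o c) 0) w)) \o
      (fun t : C => t *: v.1)).
    apply: near_eq_is_diff d2; near=> t.
    have /coneP [cS cE] : L (c t) by near: t; exact: Lc.
    by rewrite /= (dgraphE h3 (cone_domain_z0 cS)) -cE.
  have := is_diff_unique dc d3 1; rewrite /= !scale1r c0 => {1}->.
  by [].
exists (fun t => dgraph (prepotential h) (u.1 + t *: v.1)); split.
- by rewrite scale0r addr0 dgraphE ?h3 // -uE.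
- have lc : (fun t : C => u.1 + t *: v.1) @ (0 : C) --> u.1.
    have [dl _] := is_diff_line u.1 v.1 (0 : C).
    by have := differentiable_continuous dl; rewrite /prop_for /continuous_at scale0r addr0.
  have : \forall t \near (0 : C), cone_domain S (u.1 + t *: v.1).
    by apply: lc; apply: open_nbhs_nbhs; split=> //; exact: open_cone_domain hS.
  by apply: filterS => t tS; exists (u.1 + t *: v.1).
- exact: (is_derive_line v.1 (is_diff_dgraph h3 u0)).
Unshelve. all: by end_near. Qed.

Lemma lagrangean_cone_prepotential : lagrangean_cone L.
Proof.
split.
- apply: connected_continuous_connected; first exact: connected_cone_domain hS.
  apply: continuous_in_subspaceT => z; rewrite inE => zS.
  apply: differentiable_continuous.
  by case: (is_diff_dgraph h3 (cone_domain_z0 zS)).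
(* The cone is globally a graph, so the projection to the base is a holomorphic left inverse on the
   whole space. *)
- move=> u Lu; exists (cone_domain S), setT, (dgraph (prepotential h)), fst; split.
  + exact: open_cone_domain hS.
  + by split; [exact: openT|].
  + split=> z zS; last by case: (is_diff_fst z).
    by case: (is_diff_dgraph h3 (cone_domain_z0 zS)).
  + by rewrite setIT.
  + by [].
- move=> t u t0 /cone_lift [u0 tu ->]; rewrite scalerA; apply: lift_in_cone => //.
  by rewrite mulf_neq0 // eq_complex /= gt_eqF.
- move=> u Lu v; rewrite tangent_coneP //; split=> [-> w /(tangent_coneP _ Lu) -> /=|H0].
    exact: omega_hess_row.
  apply: omega_hess_row_eq => w; apply: H0.
  by apply/tangent_coneP.
Qed.

Lemma gamma_affine_lift Z :
  gamma (affine_lift h Z) (affine_lift h Z) =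
  8%:R * T (toC (Imx Z)) (toC (Imx Z)) (toC (Imx Z)).
Proof. by rewrite affine_liftE ?h3 // gamma_lift. Qed.

Lemma complex_polar_neq0 Z : tube S Z ->
  T (toC (Imx Z)) (toC (Imx Z)) (toC (Imx Z)) != 0.
Proof. by move=> tZ; rewrite cubic_polar_map fmorph_eq0 (tube_polar_neq0 hS). Qed.

Lemma gamma_affine_lift_neq0 Z : tube S Z ->
  gamma (affine_lift h Z) (affine_lift h Z) != 0.
Proof.
by move=> tZ; rewrite gamma_affine_lift mulf_neq0 ?pnatr_eq0 // complex_polar_neq0.
Qed.

Definition lift_tangent Z (w : 'rV[C]_n) : V := (tan w, hess_row h (aff Z) (tan w)).

(** A tangent vector splits into a radial part and a part coming from the affine lift; the argument
    of [lift_tangent] is the differential of [affine_coord] at [z] applied to [x]. *)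
Lemma tangent_cone_decomposition z (x : 'rV[C]_(1 + n)) : z0 z != 0 ->
  (x, hess_row h z x) = z0 x / z0 z *: (z, pot_row h z) +
    z0 z *: lift_tangent (affine_coord z)
      ((z0 z)^-1 *: (rsubmx x - z0 x / z0 z *: rsubmx z)).
Proof.
move=> z00; set y := (z0 z)^-1 *: _.
have xE : x = z0 x / z0 z *: z + z0 z *: tan y.
  apply/rowP => j; case: (fintype.split_ordP j) => k ->.
    rewrite mxE [X in _ + X]mxE row_mxEl [in X in _ + X]mxE mulr0 addr0 mxE (ord1 k).
    by rewrite divfK.
  rewrite mxE [X in _ + X]mxE row_mxEr /y !mxE mulVKf //.
  by rewrite addrC subrK.
congr (_, _) => //=.
rewrite {1}xE hess_row_linear hess_row_id //; congr (_ + _).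
rewrite hess_row_scale; congr (_ *: _); rewrite {1}(affine_coordK z00).
by rewrite hess_rowZ // z0_aff oner_neq0.
Qed.

(** A null vector is [a] times the lift plus the tangent vector of some [y]. Pairing it with the
    lift determines [a]; after substitution, the pairings with tangent vectors of the lift become
    multiples of [metric_form] at [y], which is nondegenerate. *)
Lemma nondegenerate_cone : pseudo_riemannian H S -> nondegenerate_lagrangean_cone L.
Proof.
move=> nd; split; first exact: lagrangean_cone_prepotential.
  move=> u /cone_lift [u0 tu ->]; rewrite gammaZ gammaZr; apply: mulf_neq0 => //.
  by apply: mulf_neq0; [rewrite conjC_eq0 | exact: gamma_affine_lift_neq0].
move=> u v Lu tv gv; have [u0 tu uE] := cone_lift Lu; have [uS uE'] := coneP Lu.
have vE := (tangent_coneP v Lu).1 tv.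
set Z := affine_coord u.1 in tu uE *; set Y := toC (Imx Z).
set a := z0 v.1 / z0 u.1 * z0 u.1.
set y := z0 u.1 *: ((z0 u.1)^-1 *: (rsubmx v.1 - z0 v.1 / z0 u.1 *: rsubmx u.1)).
have liftZ b w : b *: lift_tangent Z w = lift_tangent Z (b *: w).
  congr (_, _) => /=; first by rewrite scale_row_mx scaler0.
  have -> : tan (b *: w) = b *: tan w by rewrite scale_row_mx scaler0.
  by rewrite hess_row_scale.
have {}vE : v = a *: affine_lift h Z + lift_tangent Z y.
  rewrite vE (tangent_cone_decomposition _ u0) -uE' {2}uE scalerA -/Z.
  by rewrite liftZ.
have HE w : hess_row h u.1 w = hess_row h (aff Z) w.
  by rewrite [in LHS](affine_coordK u0) hess_rowZ // z0_aff oner_neq0.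
have tL w : tangent L u (lift_tangent Z w).
  by apply/tangent_coneP => //; congr (_, _); rewrite /= HE.
have tA : tangent L u (affine_lift h Z).
  apply/tangent_coneP => //; rewrite affine_liftE ?h3 //; congr (_, _) => /=.
  by rewrite HE hess_row_id // z0_aff oner_neq0.
have t0 := complex_polar_neq0 tu; rewrite -/Y in t0.
have ggA w : gamma (affine_lift h Z) (lift_tangent Z w) = 12%:R * 'i * T Y Y (conjv w).
  by rewrite affine_liftE ?h3 // gamma_lift_tan.
have YJ : conjv Y = Y by apply/rowP => j; rewrite !mxE conj_real_complex.
(* This pairing reads [8 a T(Y, Y, Y) = 12 i T(Y, Y, y)]. *)
have E1 := gv _ tA; rewrite vE gamma_linear gamma_affine_lift -/Y in E1.
rewrite -[gamma (lift_tangent Z y) _]gamma_conj ggA !rmorphM rmorph_nat /= conjCi in E1.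
rewrite cubic_polar_conj YJ conjvK in E1.
have aE : a = 12%:R * 'i * T Y Y y / (8%:R * T Y Y Y).
  apply: (@mulIf _ (8%:R * T Y Y Y)); first by rewrite mulf_neq0 ?pnatr_eq0.
  rewrite divfK ?mulf_neq0 ?pnatr_eq0 //; apply/eqP; rewrite -subr_eq0 -[X in _ == X]E1.
  by apply/eqP; ring.
have y0 : y = 0.
  apply: (complex_metric_form_nondegenerate hS hH nd tu) => q; rewrite -/Y.
  have := gv _ (tL (conjv q)); rewrite vE gamma_linear ggA conjvK.
  rewrite /lift_tangent gamma_tan conjvK -/Y aE => E2.
  (* The pairing is [12 T(Y, y, q) - 18 T(Y, Y, y) T(Y, Y, q) / T(Y, Y, Y)], where 18 comes from
     [12^2 / 8]; this is [- 6 T(Y, Y, Y)] times the metric form. *)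
  rewrite /metric_form; apply: (@mulfI _ (- 6%:R * T Y Y Y)).
    by rewrite mulf_neq0 ?oppr_eq0 ?pnatr_eq0.
  rewrite mulr0 -[RHS]E2.
  by field: (@sqr_i R).
have TY0 : T Y Y 0 = 0 by rewrite -(scale0r (0 : 'rV[C]_n)) cubic_polarZr mul0r.
rewrite vE aE y0 TY0 !(mulr0, mul0r) scale0r add0r.
by rewrite -(scale0r (0 : 'rV[C]_n)) -liftZ scale0r.
Qed.

End LagrangeanConeOfPrepotential.

(** * Charts of the tube domain and of the projectivized cone *)

Section TubeCharts.
Variables (R : realType) (n : nat) (h : mpoly n R).
Variables (H : 'rV[R]_n -> 'rV[R]_n -> 'rV[R]_n -> R) (S : set 'rV[R]_n).
Hypothesis hS : cubic_hypersurface h S.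
Hypothesis hH : polar_form h H.
Hypothesis nd : pseudo_riemannian H S.
Local Notation C := R[i].
Local Notation tube := (tube S).
Local Notation gc := (gc h).

(* The chart [c] factors through the parametrization [p] of its points by the
   tube: [t] expresses it in the coordinates of the tube, [r] is the inverse of
   [t] on its image [D]. *)
Definition tube_chart (X : Type) (p : 'rV[C]_n -> X) (c : chart R n X) :=
  open (dom c) /\
  exists (t r : 'rV[C]_n -> 'rV[C]_n) (D : set 'rV[C]_n),
    [/\ [/\ open D, D `<=` tube, holomorphic_on (dom c) t & holomorphic_on D r],
        forall z, dom c z -> [/\ D (t z), r (t z) = z & par c z = p (t z)],
        forall Z, D Z -> dom c (r Z) /\ t (r Z) = Z,
        forall Z, tube Z -> (par c @` dom c) (p Z) -> D Z
      & forall z, dom c z -> hermitian_mx (met c z) /\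
          forall w, hval (met c z) w = hval (gc (t z)) ('d t z w)].

(** The transition map is [r' \o t], through the tube. It preserves the metrics because both are
    pulled back from [gc] and [t'] undoes [r']; the overlap is open because it is the preimage of
    [D'] under [t]. *)
Lemma tube_chart_isometric X X' (p : 'rV[C]_n -> X) (p' : 'rV[C]_n -> X') f c c' :
  (forall Z, tube Z -> f (p Z) = p' Z) -> tube_chart p c -> tube_chart p' c' ->
  chart_isometric f c c'.
Proof.
move=> fp [oc [t [r [D [[oD Dtube tC rD] tP rP _ mP]]]]].
move=> [oc' [t' [r' [D' [[oD' Dtube' tC' rD'] tP' rP' imP' mP']]]]].
have fE z : dom c z -> f (par c z) = p' (t z).
  by move=> /tP [Dt _ ->]; rewrite fp //; exact: Dtube.
have DE z : dom c z /\ (par c' @` dom c') (f (par c z)) <-> dom c z /\ D' (t z).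
  split=> [[cz]|[cz D'z]]; rewrite fE //.
    by move=> ?; split=> //; apply: imP' => //; have [/Dtube] := tP z cz.
  split=> //; have [c'r tr] := rP' _ D'z; exists (r' (t z)) => //.
  by have [_ _ ->] := tP' _ c'r; rewrite tr.
have setDE : [set z | dom c z /\ (par c' @` dom c') (f (par c z))] =
    [set z | dom c z /\ D' (t z)] by apply/seteqP; split=> z /DE.
have oDD : open [set z | dom c z /\ D' (t z)].
  by apply: open_preimage => // x /tC.
exists (r' \o t); rewrite setDE; split=> //.
  by move=> z [cz D'z]; apply: differentiable_comp; [exact: tC | exact: rD'].
move=> z [cz D'z]; have [c'r tr] := rP' _ D'z; split=> //.
  by rewrite /= fE //; have [_ _ ->] := tP' _ c'r; rewrite tr.
move=> w; have [_ ->] := mP z cz; have [_ ->] := mP' _ c'r; rewrite tr.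
congr (hval _ _).
have drt : differentiable (r' \o t) z by apply: differentiable_comp; [exact: tC | exact: rD'].
have Dz : [set z | dom c z /\ D' (t z)] z by split.
have tE y : [set z | dom c z /\ D' (t z)] y -> t' ((r' \o t) y) = t y.
  by move=> [_ /rP' []].
exact: (chain_rule oDD Dz drt (tC' _ c'r) tE w).
Qed.

(** [P] is the Jacobian matrix of [t], invertible since [r] is a left inverse of [t]. Unimodular or
    not, congruence transports nondegeneracy, signature and positivity from [gc] to any chart. *)
Lemma tube_chart_congruence X (p : 'rV[C]_n -> X) c z :
  tube_chart p c -> dom c z -> exists (Z : 'rV[C]_n) (P : 'M[C]_n),
    [/\ tube Z, P \in unitmx &
        met c z = P *m gc Z *m (map_mx (@Num.conj C) P)^T].
Proof.
move=> [oc [t [r [D [[oD Dtube tC rD] tP rP _ mP]]]]] cz.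
have [Dtz rt _] := tP z cz.
have PP : lin1_mx ('d t z) *m lin1_mx ('d r (t z)) = 1%:M.
  apply/row_matrixP => i; rewrite row_mul !rowE mul_rV_lin1 mul_rV_lin1 mulmx1.
  have didE : 'd (@id 'rV[C]_n) z = id :> ('rV[C]_n -> 'rV[C]_n).
    by case: (is_diff_id z).
  have rtid y : dom c y -> r (t y) = id y by move=> /tP [].
  rewrite -[RHS]/(id _) -didE; apply: esym.
  exact: (chain_rule oc cz (tC z cz) (rD _ Dtz) rtid).
have [Pu _] := mulmx1_unit PP.
exists (t z), (lin1_mx ('d t z)); split; [exact: Dtube | exact: Pu |].
apply: hval_inj => w; rewrite hval_congruence mul_rV_lin1.
by have [_ ->] := mP z cz.
Qed.

(** * Manifold and metric properties of an atlas of tube charts *)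

Section Atlas.
Variables (X : Type) (p : 'rV[C]_n -> X) (A : set (chart R n X)).
Hypothesis p_inj : forall Z Z', tube Z -> tube Z' -> p Z = p Z' -> Z = Z'.
Hypothesis AC : forall c, A c -> tube_chart p c.
Let c0 := Chart tube p gc.
Hypothesis Ac0 : A c0.

Lemma atlas_points x : points A x <-> exists2 Z, tube Z & p Z = x.
Proof.
split=> [[c Ac [z cz <-]]|[Z tZ <-]]; last first.
  by exists c0 => //; exists Z.
have [oc [t [r [D [[oD Dtube _ _] tP _ _ _]]]]] := AC Ac.
by have [/Dtube tz _ ->] := tP z cz; exists (t z).
Qed.

Lemma atlas_hermitian_manifold : hermitian_manifold A.
Proof.
split.
- move=> c /AC [oc [t [r [D [[oD Dtube _ _] tP _ _ _]]]]]; split=> // x y.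
  rewrite !inE => cx cy; have [/Dtube tx rx ->] := tP x cx.
  have [/Dtube ty ry ->] := tP y cy => /p_inj E.
  by rewrite -rx -ry E.
- by move=> c c' /AC cc /AC cc'; exact: (@tube_chart_isometric _ _ p p).
- move=> x y /atlas_points [Z tZ <-] /atlas_points [Z' tZ' <-] xy.
  have ZZ' : Z != Z' by apply/eqP => E; apply: xy; rewrite E.
  (* Points are separated in the tube and carried over by the global chart [c0], which by itself
     also forms the countable subatlas. *)
  have := @norm_hausdorff C 'rV[C]_n; rewrite open_hausdorff => /(_ _ _ ZZ').
  move=> [[W W'] /= [ZW ZW'] [oW oW' /eqP WW']]; rewrite !inE in ZW ZW'.
  have oT := open_tube hS.
  exists c0, c0, (tube `&` W), (tube `&` W'); split.
  + by [].
  + by split; exact: openI.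
  + by split=> u [].
  + by split; [exists Z | exists Z'].
  + apply/seteqP; split=> // u [[v [tv Wv] <-] [v' [tv' Wv'] /esym vv']].
    have E := p_inj tv tv' vv'; rewrite -E in Wv'.
    by have : (W `&` W') v by []; rewrite WW'.
- exists [set c0]; first by split; [move=> _ -> | exact: countable1].
  apply/seteqP; split=> x; first by move=> [_ -> ?]; exists c0.
  by move=> /atlas_points [Z tZ <-]; exists c0 => //; exists Z.
Qed.

Lemma atlas_pseudo_kahler : pseudo_kahler A.
Proof.
split; first exact: atlas_hermitian_manifold.
- move=> c z /AC cc cz; split.
    by have [_ [t [r [D [_ _ _ _ /(_ z cz) []]]]]] := cc.
  have [Z [P [tZ Pu ->]]] := tube_chart_congruence cc cz.
  rewrite !unitmx_mul Pu (gc_unit hS hH nd tZ) /=.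
  exact: unitmx_conj_tr.
- move=> x /atlas_points [Z tZ <-]; exists c0; split=> //.
  + by exists Z.
  + by move=> i j; exact: (gc_smooth (open_tube hS) (@tube_pos _ _ _ _ hS)).
  + by move=> z i j k; exact: (gc_closed (open_tube hS) (@tube_pos _ _ _ _ hS)).
Qed.

Lemma atlas_signature k l : has_signature H S k l -> complex_signature A k.+1 l.
Proof.
move=> sg c z /AC cc cz; have [Z [P [tZ Pu ->]]] := tube_chart_congruence cc cz.
by apply: hermitian_signature_congruence => //; exact: (gc_signature hS hH).
Qed.

Lemma atlas_posdef : riemannian H S -> forall c z, A c -> dom c z -> posdef_mx (met c z).
Proof.
move=> pd c z /AC cc cz w w0; have [Z [P [tZ Pu ->]]] := tube_chart_congruence cc cz.
rewrite hval_congruence; apply: (gc_posdef hS hH pd tZ).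
apply: contraNneq w0 => wP; by rewrite -(mulmxK Pu w) wP mul0mx.
Qed.

(** Both atlases contain the tube with [gc] as a chart, and the identity of the tube is the isometry
    between these charts. *)
Lemma atlas_locally_isometric X' (p' : 'rV[C]_n -> X') (B : set (chart R n X')) :
  B (Chart tube p' gc) -> locally_isometric A B.
Proof.
move=> Bc x /atlas_points [Z tZ <-].
exists c0, (Chart tube p' gc), tube, tube, id, id; split=> //.
- by split; [split=> //; exact: open_tube hS | exists Z].
- by split=> //; exact: open_tube hS.
- by split=> // z _; case: (is_diff_id z).
- move=> z w _; congr (hval _ _).
  by have [_ ->] : is_diff z (@id 'rV[C]_n) id by exact: is_diff_id.
Qed.

End Atlas.

Lemma tube_chart_canonical X (p : 'rV[C]_n -> X) : tube_chart p (Chart tube p gc).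
Proof.
split; first exact: open_tube hS.
exists id, id, tube; split=> //=.
- by split=> //; [exact: open_tube hS | move=> z _; case: (is_diff_id z)..].
- move=> z tz; split; first exact: (gc_hermitian hS).
  move=> w; congr (hval _ _).
  by have [_ ->] : is_diff z (@id 'rV[C]_n) id by exact: is_diff_id.
Qed.

(** * The charts of the projectivized cone as tube charts *)

Local Notation V := ('rV[C]_(1 + n) * 'rV[C]_(1 + n))%type.
Local Notation z0 z := ((z : 'rV[C]_(1 + n)) 0 (lshift n (ord0 : 'I_1))).
Local Notation aff Z := (row_mx 1%:M Z : 'rV[C]_(1 + n)).
Local Notation h3 := (hypersurface_homog hS).
Local Notation L := (lagrangean_cone_of h S).

Lemma vline_scale (u : V) (a : C) : a != 0 -> <[a *: u]>%VS = <[u]>%VS.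
Proof.
move=> a0; apply/eqP; rewrite eqEsubv -!memvE; apply/andP; split.
  by apply/vlineP; exists a.
by apply/vlineP; exists a^-1; rewrite scalerA mulVf // scale1r.
Qed.

Lemma vline_eq (u v : V) : u != 0 -> <[u]>%VS = <[v]>%VS ->
  exists2 a : C, a != 0 & u = a *: v.
Proof.
move=> u0 uv; have /vlineP [a ua] : u \in <[v]>%VS by rewrite -uv memv_line.
by exists a => //; apply: contraNneq u0 => a0; rewrite ua a0 scale0r.
Qed.

Lemma affine_lift_neq0 Z : affine_lift h Z != 0.
Proof.
apply/eqP => /(congr1 (fun u : V => z0 u.1)) /=.
by rewrite z0_aff mxE => /eqP; rewrite oner_eq0.
Qed.

Lemma phi_inj Z Z' : phi h Z = phi h Z' -> Z = Z'.
Proof.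
move=> /(vline_eq (affine_lift_neq0 Z)) [a a0 /(congr1 (fun u : V => affine_coord u.1))].
by rewrite /= affine_coord_aff affine_coordZ // affine_coord_aff.
Qed.

Lemma differentiable_affine_lift Z : differentiable (affine_lift h) Z.
Proof. by case: (is_diff_affine_lift h3 Z). Qed.

(** The lift [s] is [z0] times the affine lift of its affine coordinates [t]. Scaling invariance of
    [r] therefore makes [r \o affine_lift h] the inverse of [t]. By the product rule, [ds] differs
    from [z0] times the differential of the affine lift along [t] by a multiple of [s], which the
    special metric ignores. *)
Lemma r_map_tube_chart c : r_map h S c -> tube_chart (phi h) c.
Proof.
move=> [oc [s [Q [r [sC sP [oQ nQ0 rQ Qr] QL mP]]]]]; split=> //.
have oT := open_tube hS.
pose t z := affine_coord (s z).1.
have sE z : dom c z -> [/\ z0 (s z).1 != 0, tube (t z) & s z = z0 (s z).1 *: affine_lift h (t z)].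
  by move=> /sP [Ls _ _ _]; exact: (cone_lift hS).
have QA z : dom c z -> Q (affine_lift h (t z)) /\ r (affine_lift h (t z)) = z.
  move=> cz; have [s0 tt E] := sE z cz; have [Ls Qs rs _] := sP z cz.
  have E' : affine_lift h (t z) = (z0 (s z).1)^-1 *: s z.
    by rewrite [X in _ *: X]E scalerA mulVf // scale1r.
  have i0 : (z0 (s z).1)^-1 != 0 by rewrite invr_eq0.
  by have := Qr _ _ i0 Qs; rewrite -E' rs.
have AL Z : tube Z -> L (affine_lift h Z).
  by move=> tZ; rewrite -[affine_lift h Z]scale1r; apply: (lift_in_cone hS) => //; exact: oner_neq0.
have parE z Z : dom c z -> <[affine_lift h Z]>%VS = <[s z]>%VS ->
    [/\ Q (affine_lift h Z), r (affine_lift h Z) = z & t z = Z].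
  move=> cz /(vline_eq (affine_lift_neq0 Z)) [a a0 E]; have [_ Qs rs _] := sP z cz.
  have [Qa ra] := Qr _ _ a0 Qs; rewrite -E in Qa ra; split=> //; first by rewrite ra.
  by rewrite /t -(affine_coordZ _ a0) -[_ *: _]/((a *: s z).1) -E affine_coord_aff.
have ts z : dom c z -> differentiable t z.
  move=> cz; have [s0 _ _] := sE z cz.
  apply: (@differentiable_comp _ _ _ _ (fst \o s) (@affine_coord R n)).
    by apply: differentiable_comp; [exact: sC | case: (is_diff_fst (s z))].
  exact: differentiable_affine_coord.
exists t, (r \o affine_lift h), [set Z | tube Z /\ Q (affine_lift h Z)]; split.
- split=> //.
  + by apply: open_preimage => // Z _; exact: differentiable_affine_lift.
  + by move=> Z [].
  + move=> Z [tZ QZ]; apply: differentiable_comp; last exact: rQ.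
    exact: differentiable_affine_lift.
- move=> z cz; have [s0 tt E] := sE z cz; have [Qz rz] := QA z cz; split=> //.
  by have [_ _ _ ->] := sP z cz; rewrite E vline_scale.
- move=> Z [tZ QZ]; have [z cz /(parE _ _ cz) [_ rz tz]] := QL _ (AL Z tZ) QZ.
  by rewrite /= rz.
- move=> Z tZ [z cz]; have [_ _ _ ->] := sP z cz => /esym E.
  by split=> //; have [] := parE z Z cz E.
- move=> z cz; have [hm mE] := mP z cz; split=> // w; rewrite mE.
  have [s0 tt E] := sE z cz; rewrite (gs_gc hS) // /gs.
  (* Since [s] takes values in the cone, it is near [z] the image under [dgraph] of its base
     component; this fixes the fibre part of its differential. *)
  have ds : is_diff z s (fun w => ('d (fst \o s) z w, hess_row h (s z).1 ('d (fst \o s) z w))).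
    have d1 : differentiable (fst \o s) z.
      by apply: differentiable_comp; [exact: sC | case: (is_diff_fst (s z))].
    have d2 := is_diff_comp (differentiableP d1) (is_diff_dgraph h3 s0).
    apply: near_eq_is_diff d2.
    have nc : \forall y \near z, dom c y by exact: open_nbhs_nbhs.
    near=> y; have /sP [Ls _ _ _] : dom c y by near: y.
    have [cs ->] := coneP hS Ls.
    by rewrite /= (dgraphE h3 (cone_domain_z0 cs)).
  have fs : differentiable (fst \o s) z.
    by apply: differentiable_comp; [exact: sC | case: (is_diff_fst (s z))].
  have dt := is_diff_comp (differentiableP fs) (is_diff_affine_coord s0).
  have [Ls _ _ _] := sP z cz; have [_ sE'] := coneP hS Ls.
  set dx := 'd (fst \o s) z w.
  pose y := (z0 (s z).1)^-1 *: (rsubmx dx - z0 dx / z0 (s z).1 *: rsubmx (s z).1).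
  have e1 : 'd s z w = (dx, hess_row h (s z).1 dx).
    exact: (congr1 (fun f : 'rV[C]_n -> V => f w) (diff_val (is_diff_def := ds))).
  have e3 : 'd t z w = y.
    exact: (congr1 (fun f : 'rV[C]_n -> 'rV[C]_n => f w) (diff_val (is_diff_def := dt))).
  have e2 : 'd (affine_lift h) (t z) y = lift_tangent h (t z) y.
    exact: (congr1 (fun f : 'rV[C]_n -> V => f y)
      (diff_val (is_diff_def := is_diff_affine_lift h3 (t z)))).
  have key (lam b : C) v : lam != 0 -> s z = lam *: affine_lift h (t z) ->
      special_metric (s z) (lam *: v + b *: s z) = special_metric (affine_lift h (t z)) v.
    move=> lam0 ->; rewrite scalerA; apply: special_metric_scale => //.
    exact: (gamma_affine_lift_neq0 hS).
  transitivity (special_metric (affine_lift h (t z)) (lift_tangent h (t z) y)).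
    rewrite -(key _ (z0 dx / z0 (s z).1) _ s0 E); congr (special_metric _ _).
    by rewrite e1 (tangent_cone_decomposition h _ s0) -sE' addrC.
  congr (special_metric _ _); apply: esym.
  exact: (etrans (congr1 ('d (affine_lift h) (t z)) e3) e2).
Unshelve. all: by end_near. Qed.

Lemma canonical_chart_r_map : r_map h S (Chart tube (phi h) gc).
Proof.
have oT := open_tube hS; split=> //.
(* The open set is the affine part of the projective space, and the inverse is given by the affine
   coordinates. *)
exists (affine_lift h), [set u : V | z0 u.1 != 0], (fun u => affine_coord u.1); split.
- by move=> Z _; exact: differentiable_affine_lift.
- move=> Z tZ; split=> //=.
  + by rewrite -[affine_lift h Z]scale1r; apply: (lift_in_cone hS) => //; exact: oner_neq0.
  + by rewrite z0_aff oner_neq0.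
  + exact: affine_coord_aff.
- split.
  + rewrite openE => u u0.
    by have := near_z0_neq0 u0; apply: cvg_fst.
  + by rewrite /= mxE eqxx.
  + move=> u u0; apply: (@differentiable_comp _ _ _ _ fst (@affine_coord R n)).
      by case: (is_diff_fst u).
    exact: differentiable_affine_coord.
  + by move=> u a a0 u0; split; rewrite /= ?mxE ?mulf_neq0 // affine_coordZ.
- move=> u Lu _; have [u0 tu uE] := cone_lift hS Lu.
  by exists (affine_coord u.1) => //; rewrite {1}uE vline_scale.
- move=> Z tZ; split; first exact: (gc_hermitian hS).
  by move=> w; rewrite (gs_gc hS).
Qed.

Lemma biholomorphic_isometry_phi :
  biholomorphic_isometry (phi h) (tube_domain h S) (r_map h S).
Proof.
have At c : tube_domain h S c -> tube_chart idfun c.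
  by move=> ->; exact: tube_chart_canonical.
have Ac0 : tube_domain h S (Chart tube idfun gc) by [].
(* An inverse obtained by choice; only its values on the image of the tube matter. *)
pose g y := get [set Z | tube Z /\ phi h Z = y].
have gphi Z : tube Z -> g (phi h Z) = Z.
  move=> tZ; have [_ /phi_inj //] : [set Z' | tube Z' /\ phi h Z' = phi h Z] (g (phi h Z)).
  by apply: (@getPex _ [set Z' | tube Z' /\ phi h Z' = phi h Z]); exists Z.
exists g; split.
- move=> x /(atlas_points At Ac0) [Z tZ <-]; split; last exact: gphi.
  by apply/(atlas_points r_map_tube_chart canonical_chart_r_map); exists Z.
- move=> y /(atlas_points r_map_tube_chart canonical_chart_r_map) [Z tZ <-].
  rewrite gphi //; split=> //.
  by apply/(atlas_points At Ac0); exists Z.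
- move=> c c' /At cc /r_map_tube_chart cc'; split.
    exact: (@tube_chart_isometric _ _ idfun (phi h)).
  exact: (@tube_chart_isometric _ _ (phi h) idfun).
Qed.

End TubeCharts.

Theorem theorem1p12 (R : realType) (n : nat) (h : mpoly n R)
    (H : 'rV[R]_n -> 'rV[R]_n -> 'rV[R]_n -> R) (S : set 'rV[R]_n) :
  cubic_hypersurface h S -> polar_form h H -> pseudo_riemannian H S ->
  (forall k l : nat, has_signature H S k l ->
     [/\ forall Z w, tube S Z -> hval (gc h Z) w = gs h Z w,
         nondegenerate_lagrangean_cone (lagrangean_cone_of h S),
         biholomorphic_isometry (phi h) (tube_domain h S) (r_map h S),
         special_pseudo_kahler (tube_domain h S) /\
         complex_signature (tube_domain h S) k.+1 l
       & special_pseudo_kahler (r_map h S) /\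
         complex_signature (r_map h S) k.+1 l]) /\
  (riemannian H S -> special_kahler (r_map h S)).
Proof.
move=> hS hH nd.
have At c : tube_domain h S c -> tube_chart h S idfun c.
  by move=> ->; exact: (tube_chart_canonical hS).
have At0 : tube_domain h S (Chart (tube S) idfun (gc h)) by [].
have Ar c : r_map h S c -> tube_chart h S (phi h) c by exact: (r_map_tube_chart hS).
have Ar0 : r_map h S (Chart (tube S) (phi h) (gc h)) := canonical_chart_r_map hS.
have t_inj Z Z' : tube S Z -> tube S Z' -> idfun Z = idfun Z' -> Z = Z' by [].
have r_inj Z Z' : tube S Z -> tube S Z' -> phi h Z = phi h Z' -> Z = Z'.
  by move=> _ _; exact: phi_inj.
have cone := nondegenerate_cone hS hH nd.
(* [r_map] is by definition the projectivization of the cone, so its global chart over the tube is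
   the target for both atlases. *)
have spr : special (r_map h S).
  by exists (lagrangean_cone_of h S); split=> //; exact: (atlas_locally_isometric hS Ar Ar0 Ar0).
have spt : special (tube_domain h S).
  by exists (lagrangean_cone_of h S); split=> //; exact: (atlas_locally_isometric hS At At0 Ar0).
have pkt := atlas_pseudo_kahler hS hH nd t_inj At At0.
have pkr := atlas_pseudo_kahler hS hH nd r_inj Ar Ar0.
split=> [k l sg|pd]; last first.
  split; last exact: spr.
  by split; [exact: pkr | exact: (atlas_posdef hS hH Ar pd)].
split=> //.
- by move=> Z w tZ; exact: (gs_gc hS).
- exact: (biholomorphic_isometry_phi hS).
- by split=> //; exact: (atlas_signature hS hH At sg).
- by split=> //; exact: (atlas_signature hS hH Ar sg).
Qed.
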